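(* Let $(\varepsilon_n)_{n=1}^\infty$ be a strictly decreasing sequence of positive real numbers converging sufficiently fast to $0$ (with $\varepsilon_1$ small), and let $D_i=(D_{i,n})_{n=1}^\infty$, $i\in\mathbb{N}$, be the associated bases of neighborhoods in $[0,1]$. Then the $\ell_2$-sum $Z=\ell_2\text{-}\bigoplus_{i=1}^\infty X_{D_i}$ is MLUR, has the D2P, has the LD2P+, and has convex combinations of slices of arbitrarily small diameter; that is, for every $\delta>0$ there exist $m\in\mathbb{N}$, slices $S_1,\dots,S_m$ of $B_Z$ and $\lambda_1,\dots,\lambda_m\ge 0$ with $\sum_{j=1}^m\lambda_j=1$ such that the set $\sum_{j=1}^m\lambda_jS_j$ has diameter less than $\delta$.
   Context: ''Converging sufficiently fast to $0$ (with $\varepsilon_1$ small)'' means: there is a sequence $(\eta_n)_{n=1}^\infty$ of positive numbers such that the conclusion holds for every strictly decreasing sequence $(\varepsilon_n)$ of positive reals with $\varepsilon_n\le\eta_n$ for all $n$ (and hence, in particular, with $\varepsilon_n\to0$). Construction of the bases. For each level $\ell\ge1$ and each $j\in\{1,\dots,2^\ell\}$ put $n=2^\ell-2+j$ and $$D_{1,n}=\big((j-1)2^{-\ell}-\varepsilon_n,\ j2^{-\ell}+\varepsilon_n\big)\cap[0,1].$$ Thus level 1 consists of $D_{1,1}=[0,2^{-1}+\varepsilon_1)$ and $D_{1,2}=(2^{-1}-\varepsilon_2,1]$; level 2 consists of $D_{1,3}=[0,2^{-2}+\varepsilon_3)$, $D_{1,4}=(2^{-2}-\varepsilon_4,2\cdot2^{-2}+\varepsilon_4)$,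 $D_{1,5}=(2\cdot2^{-2}-\varepsilon_5,3\cdot2^{-2}+\varepsilon_5)$, $D_{1,6}=(3\cdot2^{-2}-\varepsilon_6,1]$; and so on. For $i\ge1$, $D_i=(D_{i,n})_{n=1}^\infty$ is the sequence of those intervals of $(D_{1,n})_{n}$ starting from level $i$, re-indexed from $1$: $D_{i,n}=D_{1,\,n+2^i-2}$. Each $D_i$ is a base for the topology of $[0,1]$. $X_{D_i}$ is the space $C[0,1]$ of real-valued continuous functions on $[0,1]$ with the norm $\|x\|_{D_i}=\big(\sum_{n=1}^\infty2^{-n}\|x\|_{i,n}^2\big)^{1/2}$, where $\|x\|_{i,n}=\sup_{d\in D_{i,n}}|x(d)|$. The space $Z=\ell_2\text{-}\bigoplus_{i}X_{D_i}$ consists of sequences $(x_i)$, $x_i\in X_{D_i}$, with $\|(x_i)\|=(\sum_i\|x_i\|_{D_i}^2)^{1/2}<\infty$. For a Banach space $X$, $B_X$ and $S_X$ denote its closed unit ball and unit sphere. A slice of $B_X$ is a set $S(x^*,\varepsilon)=\{x\in B_X:x^*(x)>1-\varepsilon\}$ with $x^*\in S_{X^*}$, $\varepsilon>0$. $X$ is midpoint locally uniformly rotund (MLUR) if for every $x\in S_X$ and every sequence $(x_n)$ in $X$ with $\|x+x_n\|\to1$ and $\|x-x_n\|\to1$ one has $\|x_n\|\to0$. $X$ has the diameter 2 property (D2P) if every non-empty relatively weakly open subset of $B_X$ has diameter $2$. $X$ has the local diameter 2 property + (LD2P+) if for every $x^*\in S_{X^*}$, every $\varepsilon>0$, every $\delta>0$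 and every $x\in S(x^*,\varepsilon)\cap S_X$ there exists $y\in S(x^*,\varepsilon)$ with $\|x-y\|>2-\delta$. *)

(* Defs.v *)
From HB Require Import structures.
From mathcomp Require Import all_boot all_order all_algebra.
From mathcomp Require Import all_classical all_reals all_analysis.
From mathcomp Require Import lra ring zify.

Set Implicit Arguments.
Unset Strict Implicit.
Unset Printing Implicit Defensive.

Import Order.TTheory GRing.Theory Num.Theory.
Import numFieldNormedType.Exports.

Local Open Scope classical_set_scope.
Local Open Scope ring_scope.

Section SquareSummable.
Context {R : realType}.
Implicit Types (u v w : nat -> R) (m : nat).

Definition sqsum m u : \bar R := \sum_(m <= i <oo) ((u i) ^+ 2)%:E.

Lemma sqsum_ge0 m u : (0 <= sqsum m u)%E.
Proof. by apply: nneseries_ge0 => n _ _; rewrite lee_fin sqr_ge0. Qed.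

Lemma sqsum_psum m u n : (sqsum m u < +oo)%E ->
  \sum_(m <= i < n) u i ^+ 2 <= fine (sqsum m u).
Proof.
move=> uoo; rewrite -lee_fin fineK ?ge0_fin_numE ?sqsum_ge0// -sumEFin.
by apply: nneseries_lim_ge => k _ _; rewrite lee_fin sqr_ge0.
Qed.

Lemma sqsum_le m u (C : R) :
  (forall n, \sum_(m <= i < n) u i ^+ 2 <= C) -> (sqsum m u <= C%:E)%E.
Proof.
move=> h; apply: lime_le.
  by apply: is_cvg_nneseries => n _ _; rewrite lee_fin sqr_ge0.
by apply: nearW => n; rewrite sumEFin lee_fin.
Qed.

Lemma sqsumD m u v w : (forall n, 0 <= w n <= u n + v n) ->
  (sqsum m u < +oo)%E -> (sqsum m v < +oo)%E ->
  (sqsum m w < +oo)%E /\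
  Num.sqrt (fine (sqsum m w)) <=
    Num.sqrt (fine (sqsum m u)) + Num.sqrt (fine (sqsum m v)).
Proof.
move=> wuv uoo voo.
set A := Num.sqrt (fine (sqsum m u)); set B := Num.sqrt (fine (sqsum m v)).
have A0 : 0 <= A by exact: sqrtr_ge0.
have B0 : 0 <= B by exact: sqrtr_ge0.
have key e : 0 < e -> (sqsum m w <= ((A + B + e *+ 2) ^+ 2)%:E)%E.
  move=> e0; apply: sqsum_le => n.
  have a0 : 0 < A + e by rewrite ltr_wpDl.
  have b0 : 0 < B + e by rewrite ltr_wpDl.
  have hA : \sum_(m <= i < n) u i ^+ 2 <= (A + e) ^+ 2.
    rewrite (le_trans (sqsum_psum n uoo))//.
    rewrite -(@sqr_sqrtr _ (fine _)) ?fine_ge0 ?sqsum_ge0//.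
    by rewrite ler_sqr ?nnegrE ?(ltW a0)// lerDl ltW.
  have hB : \sum_(m <= i < n) v i ^+ 2 <= (B + e) ^+ 2.
    rewrite (le_trans (sqsum_psum n voo))//.
    rewrite -(@sqr_sqrtr _ (fine _)) ?fine_ge0 ?sqsum_ge0//.
    by rewrite ler_sqr ?nnegrE ?(ltW b0)// lerDl ltW.
  set a := A + e in a0 hA *; set b := B + e in b0 hB *.
  have -> : A + B + e *+ 2 = a + b by rewrite /a /b; ring.
  apply: (@le_trans _ _ (\sum_(m <= i < n)
      ((1 + b / a) * u i ^+ 2 + (1 + a / b) * v i ^+ 2))).
    apply: ler_sum => i _; have /andP[w0 wi] := wuv i.
    apply: (@le_trans _ _ ((u i + v i) ^+ 2)).
      by rewrite ler_sqr ?nnegrE// (le_trans w0).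
    rewrite -subr_ge0.
    have -> : (1 + b / a) * u i ^+ 2 + (1 + a / b) * v i ^+ 2
        - (u i + v i) ^+ 2 = (b * u i - a * v i) ^+ 2 / (a * b).
      by field; rewrite !gt_eqF.
    by rewrite divr_ge0 ?sqr_ge0// ltW// mulr_gt0.
  rewrite big_split/= -!mulr_sumr.
  apply: (@le_trans _ _ ((1 + b / a) * a ^+ 2 + (1 + a / b) * b ^+ 2)).
    by apply: lerD; apply: ler_wpM2l => //; rewrite addr_ge0// divr_ge0// ltW.
  by rewrite le_eqVlt; apply/orP; left; apply/eqP; field; rewrite !gt_eqF.
have woo : (sqsum m w < +oo)%E by rewrite (le_lt_trans (key _ ltr01))// ltry.
split => //; apply/ler_addgt0Pr => e e0.
have e2 : 0 < e / 2 by rewrite divr_gt0.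
have := key _ e2; rewrite -(@fineK _ (sqsum m w)) ?ge0_fin_numE ?sqsum_ge0//.
have -> : (e / 2) *+ 2 = e by field.
rewrite lee_fin => h.
rewrite -(ger0_norm (_ : 0 <= A + B + e)) ?addr_ge0 ?(ltW e0)//.
by rewrite -sqrtr_sqr ler_wsqrtr.
Qed.

Lemma sqsumZ m u v (l : R) : (forall n, u n = l * v n) ->
  (sqsum m v < +oo)%E ->
  (sqsum m u < +oo)%E /\
  Num.sqrt (fine (sqsum m u)) = `|l| * Num.sqrt (fine (sqsum m v)).
Proof.
move=> uv voo.
have -> : sqsum m u = ((l ^+ 2)%:E * sqsum m v)%E.
  rewrite /sqsum -nneseriesZl; last by move=> n _; rewrite lee_fin sqr_ge0.
  by apply: eq_eseriesr => n _; rewrite uv exprMn EFinM.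
have vfin : sqsum m v \is a fin_num by rewrite ge0_fin_numE ?sqsum_ge0.
rewrite -(fineK vfin) -EFinM/= ltry; split => //.
by rewrite sqrtrM ?sqr_ge0// sqrtr_sqr.
Qed.

Lemma sqsum_eq0 m u : (sqsum m u < +oo)%E ->
  Num.sqrt (fine (sqsum m u)) = 0 -> forall n, (m <= n)%N -> u n = 0.
Proof.
move=> uoo /eqP; rewrite sqrtr_eq0 => u0 n mn.
have := sqsum_psum n.+1 uoo; rewrite big_nat_recr//= => h.
have s0 : 0 <= \sum_(m <= i < n) u i ^+ 2.
  by apply: sumr_ge0 => i _; rewrite sqr_ge0.
apply/eqP; rewrite -sqrf_eq0 eq_le sqr_ge0 andbT.
by apply: le_trans u0; apply: le_trans h; rewrite lerDr.
Qed.

End SquareSummable.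

Section L2Sum.
Context {R : realType}.
Variable X : nat -> normedModType R.

Record l2sum := L2Sum {
  l2seq :> forall i, X i ;
  l2sumP : (\sum_(0 <= i <oo) (`|l2seq i| ^+ 2)%:E < +oo)%E }.

HB.instance Definition _ := gen_eqMixin l2sum.
HB.instance Definition _ := gen_choiceMixin l2sum.

Lemma l2sum_inj (x y : l2sum) : (forall i, x i = y i) -> x = y.
Proof.
case: x y => [x hx] [y hy] /= xy.
have {}xy : x = y by exact/functional_extensionality_dep.
by subst y; congr L2Sum; exact: Prop_irrelevance.
Qed.

Lemma l2sum_zero_subproof : (\sum_(0 <= i <oo) (`|0 : X i| ^+ 2)%:E < +oo)%E.
Proof. by rewrite eseries0 ?ltry// => i _ _; rewrite normr0 expr0n. Qed.

Lemma l2sum_opp_subproof (x : l2sum) :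
  (\sum_(0 <= i <oo) (`|- x i| ^+ 2)%:E < +oo)%E.
Proof. by under eq_eseriesr do rewrite normrN; exact: l2sumP. Qed.

Lemma l2sum_add_subproof (x y : l2sum) :
  (\sum_(0 <= i <oo) (`|x i + y i| ^+ 2)%:E < +oo)%E.
Proof.
apply: (@sqsumD _ 0 (fun i => `|x i|) (fun i => `|y i|)
  (fun i => `|x i + y i|) _ (l2sumP x) (l2sumP y)).1 => i.
by rewrite normr_ge0 ler_normD.
Qed.

Lemma l2sum_scale_subproof (l : R) (x : l2sum) :
  (\sum_(0 <= i <oo) (`|l *: x i| ^+ 2)%:E < +oo)%E.
Proof.
apply: (@sqsumZ _ 0 (fun i => `|l *: x i|) (fun i => `|x i|) `|l| _
  (l2sumP x)).1 => i.
by rewrite normrZ.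
Qed.

Definition l2sum_zero := L2Sum l2sum_zero_subproof.
Definition l2sum_opp x := L2Sum (l2sum_opp_subproof x).
Definition l2sum_add x y := L2Sum (l2sum_add_subproof x y).
Definition l2sum_scale l x := L2Sum (l2sum_scale_subproof l x).

Lemma l2sum_addA : associative l2sum_add.
Proof. by move=> x y z; apply: l2sum_inj => i; exact: addrA. Qed.

Lemma l2sum_addC : commutative l2sum_add.
Proof. by move=> x y; apply: l2sum_inj => i; exact: addrC. Qed.

Lemma l2sum_add0 : left_id l2sum_zero l2sum_add.
Proof. by move=> x; apply: l2sum_inj => i; exact: add0r. Qed.

Lemma l2sum_addN : left_inverse l2sum_zero l2sum_opp l2sum_add.
Proof. by move=> x; apply: l2sum_inj => i; exact: addNr. Qed.

HB.instance Definition _ := GRing.isZmodule.Build l2sum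
  l2sum_addA l2sum_addC l2sum_add0 l2sum_addN.

Lemma l2sum_scaleA a b (x : l2sum) :
  l2sum_scale a (l2sum_scale b x) = l2sum_scale (a * b) x.
Proof. by apply: l2sum_inj => i; exact: scalerA. Qed.

Lemma l2sum_scale1 : left_id 1 l2sum_scale.
Proof. by move=> x; apply: l2sum_inj => i; exact: scale1r. Qed.

Lemma l2sum_scaleDr : right_distributive l2sum_scale +%R.
Proof. by move=> a x y; apply: l2sum_inj => i; exact: scalerDr. Qed.

Lemma l2sum_scaleDl (x : l2sum) : {morph l2sum_scale^~ x : a b / a + b}.
Proof. by move=> a b; apply: l2sum_inj => i; exact: scalerDl. Qed.

HB.instance Definition _ := GRing.Zmodule_isLmodule.Build R l2sum
  l2sum_scaleA l2sum_scale1 l2sum_scaleDr l2sum_scaleDl.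

Definition l2norm (x : l2sum) : R :=
  Num.sqrt (fine (\sum_(0 <= i <oo) (`|x i| ^+ 2)%:E)).

Lemma l2normD (x y : l2sum) : l2norm (x + y) <= l2norm x + l2norm y.
Proof.
apply: (@sqsumD _ 0 (fun i => `|x i|) (fun i => `|y i|)
  (fun i => `|x i + y i|) _ (l2sumP x) (l2sumP y)).2 => i.
by rewrite normr_ge0 ler_normD.
Qed.

Lemma l2normZ (l : R) (x : l2sum) : l2norm (l *: x) = `|l| * l2norm x.
Proof.
rewrite -[in RHS](normr_id l).
apply: (@sqsumZ _ 0 (fun i => `|l *: x i|) (fun i => `|x i|) `|l| _
  (l2sumP x)).2 => i.
by rewrite normrZ.
Qed.

Lemma l2norm_eq0 (x : l2sum) : l2norm x = 0 -> x = 0.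
Proof.
move=> x0; apply: l2sum_inj => i; apply/normr0_eq0.
exact: (@sqsum_eq0 _ 0 (fun i => `|x i|) (l2sumP x) x0 i).
Qed.

HB.instance Definition _ := Lmodule_isNormed.Build R l2sum
  l2normD l2normZ l2norm_eq0.

End L2Sum.

Section C01.
Variable R : realType.

Definition I01 : set R := `[0, 1].

Definition C01 := continuousType I01 R.

HB.instance Definition _ := Choice.on C01.

Lemma C01_inj (x y : C01) : (forall d, x d = y d) -> x = y.
Proof. by move=> xy; apply/continuousEP. Qed.

Lemma C01_add_subproof (x y : C01) : continuous (fun d => x d + y d).
Proof. by move=> d; apply: (@continuousD R R I01 x y d); exact: cts_fun. Qed.

Lemma C01_opp_subproof (x : C01) : continuous (fun d => - x d).
Proof. by move=> d; apply: (@continuousN R R I01 x d); exact: cts_fun. Qed.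

Lemma C01_scale_subproof (l : R) (x : C01) : continuous (fun d => l * x d).
Proof.
by move=> d; apply: (@continuousM R I01 (cst l) x d); exact: cts_fun.
Qed.

Definition C01_zero : C01 := cst (0 : R).
Definition C01_opp (x : C01) : C01 := mkcts (@C01_opp_subproof x).
Definition C01_add (x y : C01) : C01 := mkcts (@C01_add_subproof x y).
Definition C01_scale (l : R) (x : C01) : C01 := mkcts (@C01_scale_subproof l x).

Lemma C01_addA : associative C01_add.
Proof. by move=> x y z; apply: C01_inj => d; exact: addrA. Qed.

Lemma C01_addC : commutative C01_add.
Proof. by move=> x y; apply: C01_inj => d; exact: addrC. Qed.

Lemma C01_add0 : left_id C01_zero C01_add.
Proof. by move=> x; apply: C01_inj => d; exact: add0r. Qed.

Lemma C01_addN : left_inverse C01_zero C01_opp C01_add.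
Proof. by move=> x; apply: C01_inj => d; exact: addNr. Qed.

HB.instance Definition _ := GRing.isZmodule.Build C01
  C01_addA C01_addC C01_add0 C01_addN.

Lemma C01_scaleA a b (x : C01) :
  C01_scale a (C01_scale b x) = C01_scale (a * b) x.
Proof. by apply: C01_inj => d; exact: mulrA. Qed.

Lemma C01_scale1 : left_id 1 C01_scale.
Proof. by move=> x; apply: C01_inj => d; exact: mul1r. Qed.

Lemma C01_scaleDr : right_distributive C01_scale +%R.
Proof. by move=> a x y; apply: C01_inj => d; exact: mulrDr. Qed.

Lemma C01_scaleDl (x : C01) : {morph C01_scale^~ x : a b / a + b}.
Proof. by move=> a b; apply: C01_inj => d; exact: mulrDl. Qed.

HB.instance Definition _ := GRing.Zmodule_isLmodule.Build R C01
  C01_scaleA C01_scale1 C01_scaleDr C01_scaleDl.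

Lemma C01_bounded (x : C01) : exists M : R, forall d, `|x d| <= M.
Proof.
pose f : R -> R := fun r => `|'valL_(0 : R) (x : I01 -> R) r|.
have cf : {within I01, continuous f}.
  apply/subspace_sigL_continuousP => d.
  have -> : sigL I01 f = fun e => `|x e|.
    apply/funext => e; rewrite /f /=.
    by have /(congr1 (fun g => g e))/= := valLK 0 (x : I01 -> R) => ->.
  apply: (@continuous_comp I01 R R x (fun r => `|r|) d); first exact: cts_fun.
  exact: norm_continuous.
have [c _ fc] := EVT_max ler01 cf.
exists (f c) => d.
have -> : `|x d| = f (set_val d).
  by rewrite /f; have /(congr1 (fun g => g d))/= := valLK 0 (x : I01 -> R) => ->.
by apply: fc; have := set_valP d.
Qed.

Definition supnorm (D : set I01) (x : C01) : R := sup [set `|x d| | d in D].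

Lemma supnorm_ub (D : set I01) (x : C01) d : D d -> `|x d| <= supnorm D x.
Proof.
move=> Dd; apply: ub_le_sup; last by exists d.
by have [M xM] := C01_bounded x; exists M => _ [e _ <-].
Qed.

Lemma supnorm_ge0 (D : set I01) (x : C01) : 0 <= supnorm D x.
Proof.
have [->|/set0P[d Dd]] := eqVneq D set0; first by rewrite /supnorm image_set0 sup0.
by rewrite (le_trans _ (supnorm_ub x Dd)).
Qed.

Lemma supnorm_le (D : set I01) (x : C01) (M : R) : 0 <= M ->
  (forall d, D d -> `|x d| <= M) -> supnorm D x <= M.
Proof.
move=> M0 xM; have [->|/set0P[d Dd]] := eqVneq D set0.
  by rewrite /supnorm image_set0 sup0.
by apply: ge_sup; [exists `|x d|, d|move=> _ [e De <-]; exact: xM].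
Qed.

Lemma supnormD (D : set I01) (x y : C01) :
  supnorm D (x + y) <= supnorm D x + supnorm D y.
Proof.
apply: supnorm_le => [|d Dd]; first by rewrite addr_ge0 ?supnorm_ge0.
by rewrite (le_trans (ler_normD _ _))// lerD ?supnorm_ub.
Qed.

Lemma supnormZ (D : set I01) (l : R) (x : C01) :
  supnorm D (l *: x) = `|l| * supnorm D x.
Proof.
have Zle (k : R) (y : C01) : supnorm D (k *: y) <= `|k| * supnorm D y.
  apply: supnorm_le => [|d Dd]; first by rewrite mulr_ge0 ?supnorm_ge0.
  by rewrite normrM ler_wpM2l// supnorm_ub.
have [->|l0] := eqVneq l 0.
  by apply/eqP; rewrite normr0 mul0r eq_le supnorm_ge0 (le_trans (Zle _ _))//
    normr0 mul0r.
apply/eqP; rewrite eq_le Zle/=.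
have := Zle l^-1 (l *: x); rewrite scalerA mulVf// scale1r normfV.
by rewrite ler_pdivlMl ?normr_gt0.
Qed.

End C01.

Arguments I01 : clear implicits.

Section DyadicBases.
Variable R : realType.
Variable eps : nat -> {posnum R}.

(* Sequences are numbered from 1 as in the mathematical text: [eps 0] and
   [baseD1 0] are never used by [baseD i n] when [i] and [n] are positive. *)

(* [n = 2 ^ l - 2 + j] with [1 <= j <= 2 ^ l] iff [2 ^ l <= n + 1 < 2 ^ (l + 1)],
   whence the level [l] and the position [j] below; see [baseD1E]. *)
Definition blevel (n : nat) : nat := trunc_log 2 n.+1.
Definition bpos (n : nat) : nat := (n.+2 - 2 ^ blevel n)%N.

Definition baseD1 (n : nat) : set (I01 R) :=
  [set d | ((bpos n)%:R - 1) / 2 ^+ blevel n - (eps n)%:num < set_val d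
           < (bpos n)%:R / 2 ^+ blevel n + (eps n)%:num].

Lemma baseD1E (l j : nat) : (0 < l)%N -> (1 <= j <= 2 ^ l)%N ->
  let n := (2 ^ l - 2 + j)%N in
  baseD1 n = [set d | (j%:R - 1) / 2 ^+ l - (eps n)%:num < set_val d
                      < j%:R / 2 ^+ l + (eps n)%:num].
Proof.
move=> l0 /andP[j1 jl] n.
have l2 : (2 <= 2 ^ l)%N by rewrite -{1}(expn1 2) leq_exp2l.
have nl : blevel n = l by apply: trunc_log_eq => //; rewrite expnS /n; lia.
have nj : bpos n = j by rewrite /bpos nl /n; lia.
by rewrite /baseD1 nl nj.
Qed.

Definition baseD (i n : nat) : set (I01 R) := baseD1 (n + 2 ^ i - 2)%N.

Lemma baseD_cover (i : nat) (d : I01 R) : exists2 n, (1 <= n)%N & baseD i n d.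
Proof.
have := set_valP d; rewrite /I01/= in_itv/= => /andP[d0 d1].
have p0 : 0 < 2 ^+ i :> R by rewrite exprn_gt0.
have pn : (0 < 2 ^ i)%N by rewrite expn_gt0.
suff [k ki kd] : exists2 k, (k < 2 ^ i)%N &
    k%:R / 2 ^+ i <= set_val d <= k.+1%:R / 2 ^+ i.
  exists k.+1 => //; rewrite /baseD /baseD1 /=.
  have nE : (k.+1 + 2 ^ i - 2 = k + 2 ^ i - 1)%N by lia.
  have lE : blevel (k.+1 + 2 ^ i - 2) = i.
    by apply: trunc_log_eq => //; rewrite expnS; lia.
  have jE : bpos (k.+1 + 2 ^ i - 2) = k.+1 by rewrite /bpos lE; lia.
  rewrite lE jE -[in _ - 1]natr1 addrK; case/andP: kd => kd dk.
  by rewrite ltrBlDr (le_lt_trans kd) ?ltrDl//= (le_lt_trans dk)// ltrDl.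
have [d1'|d1'] := eqVneq (set_val d) 1.
  exists (2 ^ i).-1; first by rewrite prednK.
  rewrite prednK// d1' natrX divff ?gt_eqF// lexx andbT ler_pdivrMr// mul1r.
  by rewrite -natrX ler_nat leq_pred.
pose t := set_val d * 2 ^+ i.
have t0 : 0 <= t by rewrite mulr_ge0// ltW.
have /andP[t1 t2] := truncn_itv t0.
exists (Num.trunc t).
  rewrite -(ltr_nat R) natrX (le_lt_trans t1)// gtr_pMl//.
  by rewrite lt_neqAle d1' d1.
by rewrite ler_pdivrMr// t1 ler_pdivlMr// ltW.
Qed.

End DyadicBases.

(* [eps] and [i] do not occur in the carrier; they select the norm [normD]. *)
Definition XD {R : realType} (eps : nat -> {posnum R}) (i : nat) : Type :=
  C01 R.

Section XDNormed.
Context {R : realType}.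
Variables (eps : nat -> {posnum R}) (i : nat).

Local Notation XD := (XD eps i).

HB.instance Definition _ := GRing.Lmodule.on XD.

Definition normD (x : XD) : R :=
  Num.sqrt (fine (\sum_(1 <= n <oo)
    (2 ^- n * supnorm (baseD eps i n) x ^+ 2)%:E)).

Let a (x : XD) n := Num.sqrt (2 ^- n) * supnorm (baseD eps i n) x.

Lemma normDE (x : XD) : normD x = Num.sqrt (fine (sqsum 1 (a x))).
Proof.
congr (Num.sqrt (fine _)); apply: eq_eseriesr => n _.
by rewrite exprMn sqr_sqrtr// invr_ge0 exprn_ge0.
Qed.

Lemma normD_fin (x : XD) : (sqsum 1 (a x) < +oo)%E.
Proof.
have [M xM] := C01_bounded x.
have M0 : 0 <= M.
  have h : I01 R 0 by rewrite /I01/= in_itv/= lexx ler01.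
  exact: le_trans (normr_ge0 _) (xM (exist _ 0 (mem_set h))).
have hp n : \sum_(1 <= k < n.+1) 2 ^- k = 1 - 2 ^- n :> R.
  elim: n => [|n ih]; first by rewrite big_geq// expr0 invr1 subrr.
  rewrite big_nat_recr//= ih [in RHS]exprS exprS.
  by field; rewrite expf_neq0.
apply: (@le_lt_trans _ _ (M ^+ 2)%:E); last exact: ltry.
apply: sqsum_le => n.
apply: (@le_trans _ _ (\sum_(1 <= k < n) 2 ^- k * M ^+ 2)).
  apply: ler_sum => k _; rewrite /a exprMn sqr_sqrtr ?invr_ge0 ?exprn_ge0//.
  rewrite ler_wpM2l ?invr_ge0 ?exprn_ge0// ler_sqr ?nnegrE ?supnorm_ge0//.
  exact: supnorm_le.
rewrite -mulr_suml -[leRHS]mul1r ler_wpM2r ?sqr_ge0//.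
case: n => [|n]; first by rewrite big_geq.
by rewrite hp gerBl invr_ge0 exprn_ge0.
Qed.

Lemma normD_D (x y : XD) : normD (x + y) <= normD x + normD y.
Proof.
rewrite !normDE; apply: (sqsumD _ (normD_fin x) (normD_fin y)).2 => n.
rewrite mulr_ge0 ?sqrtr_ge0 ?supnorm_ge0//= -mulrDr.
by rewrite ler_wpM2l ?sqrtr_ge0// supnormD.
Qed.

Lemma normD_Z (l : R) (x : XD) : normD (l *: x) = `|l| * normD x.
Proof.
rewrite !normDE -[in RHS](normr_id l).
apply: (sqsumZ _ (normD_fin x)).2 => n.
by rewrite /a supnormZ mulrCA.
Qed.

Lemma normD_eq0 (x : XD) : normD x = 0 -> x = 0.
Proof.
rewrite normDE => /(sqsum_eq0 (normD_fin x)) x0.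
apply: C01_inj => d; have [n n1 nd] := baseD_cover eps i d.
have /eqP := x0 n n1; rewrite mulf_eq0 sqrtr_eq0 leNgt invr_gt0 exprn_gt0//=.
move=> /eqP s0; apply/normr0_eq0/eqP; rewrite eq_le normr_ge0 andbT -s0.
exact: supnorm_ub.
Qed.

HB.instance Definition _ := Lmodule_isNormed.Build R XD
  normD_D normD_Z normD_eq0.

End XDNormed.

(* The summands are indexed by [nat], so component [i] lives in [XD eps i.+1]. *)
Definition Z {R : realType} (eps : nat -> {posnum R}) : normedModType R :=
  l2sum (fun i => XD eps i.+1).

Section DiameterProperties.
Context {R : realType}.
Variable X : normedModType R.

Definition unit_ball : set X := [set x | `|x| <= 1].
Definition unit_sphere : set X := [set x | `|x| = 1].

Definition dual_norm (f : {linear X -> R^o}) : R :=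
  sup [set `|f x| | x in unit_ball].
(* For a discontinuous [f] the supremum is infinite and [sup] takes a default
   value, so continuity has to be required separately. *)
Definition dual_sphere : set {linear X -> R^o} :=
  [set f : {linear X -> R^o} | continuous f /\ dual_norm f = 1].

Definition slice (f : {linear X -> R^o}) (e : R) : set X :=
  [set x | unit_ball x /\ f x > 1 - e].
Definition is_slice (S : set X) : Prop :=
  exists (f : {linear X -> R^o}) (e : R),
    [/\ dual_sphere f, 0 < e & S = slice f e].

Definition weak_topology : Type :=
  sup_topology (fun f : {f : {linear X -> R^o} | continuous f} =>
    Topological.class (initial_topology (sval f))).
HB.instance Definition _ := Topological.on weak_topology.

Definition diameter (A : set X) : \bar R :=
  ereal_sup [set `|p.1 - p.2|%:E | p in A `*` A].

Definition MLUR : Prop :=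
  forall (x : X) (u : nat -> X), unit_sphere x ->
    (fun n => `|x + u n|) @ \oo --> (1 : R) ->
    (fun n => `|x - u n|) @ \oo --> (1 : R) ->
    (fun n => `|u n|) @ \oo --> (0 : R).

Definition D2P : Prop :=
  forall U : set weak_topology, open U ->
    let V : set X := U `&` unit_ball in V !=set0 -> diameter V = 2%:E.

Definition LD2Pplus : Prop :=
  forall f : {linear X -> R^o}, dual_sphere f ->
  forall e : R, 0 < e -> forall delta : R, 0 < delta ->
  forall x : X, (slice f e `&` unit_sphere) x ->
    exists2 y, slice f e y & `|x - y| > 2 - delta.

Definition set_combination (m : nat) (lambda : 'I_m -> R) (S : 'I_m -> set X) :
    set X :=
  [set \sum_j lambda j *: y j | y in [set y : 'I_m -> X | forall j, S j (y j)]].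

Definition small_convex_combinations_of_slices : Prop :=
  forall delta : R, 0 < delta ->
  exists (m : nat) (S : 'I_m -> set X) (lambda : 'I_m -> R),
    [/\ forall j, is_slice (S j),
        forall j, 0 <= lambda j,
        \sum_j lambda j = 1
      & (diameter (set_combination lambda S) < delta%:E)%E].

End DiameterProperties.

(* Main.v *)
Require Import Defs.
From HB Require Import structures.
From mathcomp Require Import all_boot all_order all_algebra.
From mathcomp Require Import all_classical all_reals all_analysis.
From mathcomp Require Import lra ring zify.
Import Order.TTheory GRing.Theory Num.Theory.
Import numFieldNormedType.Exports.
Local Open Scope classical_set_scope.
Local Open Scope ring_scope.

(** The intervals only need to shrink to points, so any sequence [eta] tending
    to [0] works; the proof takes [eta n = 1 / (n + 1)]. The four properties
    hold for the following reasons.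

    MLUR. The norm of [XD eps i] is an [l_2] norm of weighted sup seminorms over
    basic sets. If the norms of [x + v] and [x - v] are close to that of [x],
    then, by uniform convexity of [l_2] ([seqnorm_midpoint]), on each of
    finitely many basic sets the suprema of [|x + v|] and [|x - v|] hardly
    exceed that of [|x|]. Since the larger of [|x(t) + v(t)|] and
    [|x(t) - v(t)|] is [|x(t)| + |v(t)|], this makes [v] small on every basic
    set on which [x] oscillates little, and by compactness finitely many of
    those cover [[0, 1]] ([XD_local_mlur]). The local form of the property
    passes to [l_2] sums ([l2sum_local_mlur]): finitely many components of [v]
    are small by hypothesis, and the others are controlled by the tails of
    [x + v] and [x - v].

    LD2P+ and D2P. Given finitely many points of [[0, 1]], there are continuous
    functions [0 <= phi_k <= 1] with [sum_k phi_k <= 1] such that, for [k]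
    large, [phi_k] takes the value [1] near each of these points
    ([bump_peak]). The norm of [Z eps] is monotone in the pointwise absolute
    values of the components, so the signed sums of the vectors [phi_k x] are
    bounded by [x]; therefore [phi_k x] tends weakly to [0]
    ([bump_mulZ_weakly_null]), and [y_k = (1 - 2 phi_k) x] tends weakly to [x]
    with [|y_k| <= |x|]. If the points nearly realize the suprema of finitely
    many components of [x] over finitely many basic sets, then
    [|x - y_k| = 2 |phi_k x|] is almost [2 |x|] ([Z_bump_norm]). This gives
    LD2P+, and it gives D2P because every nonempty relatively weakly open subset
    of the unit ball contains a point of the unit sphere
    ([weakly_open_meets_sphere]).

    Slices. A slice given by a functional that depends on the [j]-th component
    only consists of vectors almost concentrated on that component. In the mean
    of [m] such slices, for distinct components, differences of points are
    almost means of [m] orthogonal vectors of norm at most [2], hence of norm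
    about [2 / sqrt m] ([l2sum_small_convex_combinations_of_slices]). *)

Set Implicit Arguments.
Unset Strict Implicit.
Unset Printing Implicit Defensive.

(** * Square-summable sequences *)

(** The [l_2] norm of the tail [u m, u m.+1, ...] of a real sequence; it is
    meaningful only when [sqsum m u] is finite. *)
Definition seqnorm (R : realType) (m : nat) (u : nat -> R) : R :=
  Num.sqrt (fine (sqsum m u)).

Section SeqNorm.
Context {R : realType}.
Implicit Types (u v a b c : nat -> R) (m n k : nat).

Lemma seqnorm_ge0 m u : 0 <= seqnorm m u.
Proof. exact: sqrtr_ge0. Qed.

Lemma seqnorm_sqr m u : seqnorm m u ^+ 2 = fine (sqsum m u).
Proof. by rewrite sqr_sqrtr// fine_ge0// sqsum_ge0. Qed.

Lemma psum_le_seqnorm m u n : (sqsum m u < +oo)%E ->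
  \sum_(m <= i < n) u i ^+ 2 <= seqnorm m u ^+ 2.
Proof. by rewrite seqnorm_sqr; exact: sqsum_psum. Qed.

Lemma seqnorm_sqr_le m u (C : R) :
  (forall n, \sum_(m <= i < n) u i ^+ 2 <= C) -> seqnorm m u ^+ 2 <= C.
Proof.
move=> /sqsum_le uC; have uoo := le_lt_trans uC (ltry C).
by rewrite seqnorm_sqr -lee_fin fineK// ge0_fin_numE// sqsum_ge0.
Qed.

Lemma seqnorm_le m u (C : R) : 0 <= C ->
  (forall n, \sum_(m <= i < n) u i ^+ 2 <= C ^+ 2) -> seqnorm m u <= C.
Proof.
by move=> C0 /seqnorm_sqr_le; rewrite ler_sqr ?nnegrE// seqnorm_ge0.
Qed.

Lemma seqnorm_psum_gt m u (c : R) : c < seqnorm m u ^+ 2 ->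
  exists n, c < \sum_(m <= i < n) u i ^+ 2.
Proof.
move=> cu; apply: contrapT => /forallNP h.
have : seqnorm m u ^+ 2 <= c.
  by apply: seqnorm_sqr_le => n; rewrite leNgt; exact/negP.
by rewrite leNgt cu.
Qed.

Lemma coord_le_seqnorm m u k : (sqsum m u < +oo)%E -> (m <= k)%N ->
  `|u k| <= seqnorm m u.
Proof.
move=> uoo mk; rewrite -ler_sqr ?nnegrE ?seqnorm_ge0// real_normK ?num_real//.
apply: le_trans (psum_le_seqnorm k.+1 uoo); rewrite big_nat_recr//= lerDr.
by apply: sumr_ge0 => i _; exact: sqr_ge0.
Qed.

Lemma le_seqnorm m u v : (sqsum m v < +oo)%E ->
  (forall k, (m <= k)%N -> `|u k| <= `|v k|) -> seqnorm m u <= seqnorm m v.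
Proof.
move=> voo uv; apply: seqnorm_le => [|n]; first exact: seqnorm_ge0.
apply: le_trans (psum_le_seqnorm n voo).
rewrite !big_nat; apply: ler_sum => k /andP[mk _].
by rewrite -[u k ^+ 2]real_normK ?num_real// -[v k ^+ 2]real_normK ?num_real//
  ler_sqr ?nnegrE ?uv.
Qed.

(** Lower semicontinuity: lower bounds on finitely many coordinates are enough
    to keep the norm above a given value. *)
Lemma seqnorm_lsc m u (c : R) : (sqsum m u < +oo)%E -> (forall k, 0 <= u k) ->
  c < seqnorm m u ->
  exists n (d : R), 0 < d /\ forall v, (sqsum m v < +oo)%E ->
    (forall k, 0 <= v k) ->
    (forall k, (m <= k < n)%N -> u k - d <= v k) -> c < seqnorm m v.
Proof.
move=> uoo u0 cu; have [c0|c0] := ltP c 0.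
  by exists 0%N, 1; split=> // v _ _ _; rewrite (lt_le_trans c0)// seqnorm_ge0.
have : c ^+ 2 < seqnorm m u ^+ 2 by rewrite ltr_sqr ?nnegrE ?seqnorm_ge0.
move=> /seqnorm_psum_gt[n cn]; set S2 := \sum_(_ <= _ < _) _ in cn.
pose S1 := \sum_(m <= i < n) u i.
have S10 : 0 <= S1 by exact: sumr_ge0.
have d0 : 0 < (S2 - c ^+ 2) / (2 * S1 + 1).
  by rewrite divr_gt0 ?subr_gt0//; lra.
exists n, ((S2 - c ^+ 2) / (2 * S1 + 1)); set d := _ / _ in d0 *.
split=> // v voo v0 uv.
rewrite -ltr_sqr ?nnegrE ?seqnorm_ge0//.
apply: lt_le_trans (psum_le_seqnorm n voo).
apply: (@lt_le_trans _ _ (S2 - 2 * d * S1)).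
  have dE : d * (2 * S1 + 1) = S2 - c ^+ 2.
    by rewrite /d divfK// gt_eqF//; lra.
  lra.
rewrite /S2 /S1 mulr_sumr -sumrB !big_nat; apply: ler_sum => k kn.
have := uv _ kn; have := u0 k; have := v0 k.
have [ud|du] := leP (u k) d => vk uk uvk; first by have := sqr_ge0 (v k); nra.
have : (u k - d) ^+ 2 <= v k ^+ 2 by rewrite ler_sqr ?nnegrE//; lra.
have := sqr_ge0 d; nra.
Qed.

(** The [l_2] norm is uniformly convex enough for a pointwise conclusion: if
    [c] is dominated by the mean of [a] and [b], whose norms are at most [A],
    and [A] is close to the norm of [c], then [a] and [b] cannot exceed [c] by
    much at any coordinate. *)
Lemma seqnorm_midpoint m a b c (A : R) :
  (sqsum m a < +oo)%E -> (sqsum m b < +oo)%E ->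
  (forall k, 0 <= c k) -> (forall k, 2 * c k <= a k + b k) ->
  seqnorm m a <= A -> seqnorm m b <= A ->
  forall k, (m <= k)%N ->
    a k <= c k + 2 * Num.sqrt (A ^+ 2 - seqnorm m c ^+ 2).
Proof.
move=> aoo boo c0 cab aA bA k mk.
have A0 : 0 <= A := le_trans (seqnorm_ge0 _ _) aA.
have le2 x y : 0 <= x -> 2 * x <= y -> x ^+ 2 <= (y / 2) ^+ 2 :> R.
  by move=> x0 xy; rewrite ler_sqr ?nnegrE//; lra.
have main : seqnorm m c ^+ 2 + ((a k ^+ 2 + b k ^+ 2) / 2 - c k ^+ 2) <= A ^+ 2.
  rewrite -lerBrDr; apply: seqnorm_sqr_le => n; rewrite lerBrDr.
  apply: (@le_trans _ _ (\sum_(m <= i < maxn n k.+1) (a i ^+ 2 + b i ^+ 2) / 2));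
    last first.
    rewrite -mulr_suml big_split/= ler_pdivrMr//.
    have := psum_le_seqnorm (maxn n k.+1) aoo.
    have := psum_le_seqnorm (maxn n k.+1) boo.
    have := seqnorm_ge0 m a; have := seqnorm_ge0 m b; nra.
  apply: (@le_trans _ _ (\sum_(m <= i < maxn n k.+1) c i ^+ 2 +
      ((a k ^+ 2 + b k ^+ 2) / 2 - c k ^+ 2))).
    rewrite lerD2r; have [nm|mn] := leqP n m.
      by rewrite big_geq//; apply: sumr_ge0 => i _; exact: sqr_ge0.
    rewrite [leRHS](@big_cat_nat _ _ _ n)/= ?leq_maxl ?(ltnW mn)// lerDl.
    by apply: sumr_ge0 => i _; exact: sqr_ge0.
  have ki : k \in index_iota m (maxn n k.+1).
    by rewrite mem_index_iota mk leq_max ltnSn orbT.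
  rewrite (bigD1_seq k)//= ?iota_uniq// [leRHS](bigD1_seq k)//= ?iota_uniq//.
  rewrite addrAC [c k ^+ 2 + _]addrC subrK lerD2l; apply: ler_sum => i _.
  have := c0 i; have := cab i; have := sqr_ge0 (a i - b i); nra.
set E := A ^+ 2 - _.
have Eh : ((a k + b k) / 2) ^+ 2 + ((a k - b k) / 2) ^+ 2 - c k ^+ 2 <= E.
  by rewrite /E; lra.
have E0 : 0 <= E.
  have := c0 k; have := cab k; have := sqr_ge0 ((a k - b k) / 2); nra.
have := sqr_sqrtr E0; have := sqrtr_ge0 E; set s := Num.sqrt E => s0 sE.
have ck := c0 k; have cabk := cab k.
have h1 : (a k - b k) / 2 <= s.
  rewrite leNgt; apply/negP => sl.
  have : s ^+ 2 < ((a k - b k) / 2) ^+ 2 by rewrite ltr_sqr ?nnegrE//; lra.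
  nra.
have h2 : (a k + b k) / 2 <= c k + s.
  rewrite leNgt; apply/negP => sl.
  have : (c k + s) ^+ 2 < ((a k + b k) / 2) ^+ 2.
    by rewrite ltr_sqr ?nnegrE//; lra.
  have := sqr_ge0 ((a k - b k) / 2); nra.
lra.
Qed.

End SeqNorm.

(** * Midpoint local uniform rotundity *)

(** The local, quantitative form of midpoint local uniform rotundity, at
    vectors of arbitrary norm; it passes easily to [l_2] sums. *)
Definition local_mlur (R : realType) (X : normedModType R) : Prop :=
  forall (x : X) (e : R), 0 < e -> exists2 d : R, 0 < d &
    forall v : X, `|x + v| <= `|x| + d -> `|x - v| <= `|x| + d -> `|v| <= e.

Section Mlur.
Context {R : realType}.

Lemma local_mlur_MLUR (X : normedModType R) : local_mlur X -> MLUR X.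
Proof.
move=> mX x u x1 ux1 ux2; apply/cvgrPdist_le => e e0.
have [d d0 xd] := mX x e e0; rewrite x1 in xd.
move/cvgrPdist_le : ux1 => /(_ d d0); move/cvgrPdist_le : ux2 => /(_ d d0).
apply: filterS2 => n /ler_distlCDr h1 /ler_distlCDr h2.
by rewrite sub0r normrN normr_id xd.
Qed.

(** Finitely many positive thresholds have a common lower bound. *)
Lemma uniform_bound (P : nat -> R -> Prop) n :
  (forall k d d', 0 < d' <= d -> P k d -> P k d') ->
  (forall k, exists2 d : R, 0 < d & P k d) ->
  exists2 d : R, 0 < d & forall k, (k < n)%N -> P k d.
Proof.
move=> mono ex; elim: n => [|n [d d0 dP]]; first by exists 1.
have [d' d'0 d'P] := ex n; have m0 : 0 < Num.min d d' by rewrite lt_min d0.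
exists (Num.min d d') => // k; rewrite ltnS leq_eqVlt => /predU1P[->|kn].
  by apply: mono d'P; rewrite m0 ge_min lexx orbT.
by apply: mono (dP _ kn); rewrite m0 ge_min lexx.
Qed.

Lemma sqrD_close (C m : R) : 0 <= C -> 0 < m ->
  exists2 d : R, 0 < d & (C + d) ^+ 2 - C ^+ 2 <= m.
Proof.
move=> C0 m0; have C1 : 0 < 2 * C + 1 by lra.
have h0 : 0 < m / (2 * C + 1) by rewrite divr_gt0.
exists (Num.min 1 (m / (2 * C + 1))); first by rewrite lt_min ltr01.
set d := Num.min _ _.
have d1 : d <= 1 by rewrite ge_min lexx.
have : d * (2 * C + 1) <= m by rewrite -ler_pdivlMr// ge_min lexx orbT.
have d0 : 0 < d by rewrite lt_min ltr01.
nra.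
Qed.

Variable X : nat -> normedModType R.
Implicit Types x y v : l2sum X.

Lemma l2sum_normE x : `|x| = seqnorm 0 (fun i => `|x i|).
Proof. by []. Qed.

Lemma l2sum_coord_le x i : `|x i| <= `|x|.
Proof.
by have := @coord_le_seqnorm _ 0 (fun i => `|x i|) i (l2sumP x) isT;
  rewrite normr_id.
Qed.

Lemma l2sum_local_mlur : (forall i, local_mlur (X i)) -> local_mlur (l2sum X).
Proof.
move=> mX x e e0.
have [n nx] : exists n, `|x| ^+ 2 - e ^+ 2 / 4 < \sum_(0 <= i < n) `|x i| ^+ 2.
  apply: seqnorm_psum_gt; rewrite -l2sum_normE ltrBlDr ltrDl.
  by rewrite divr_gt0// exprn_gt0.
have n0 : 0 < n.+1%:R :> R by rewrite ltr0n.
pose e' : R := e / (2 * n.+1%:R).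
have e'0 : 0 < e' by rewrite divr_gt0// mulr_gt0.
have [D D0 xD] := @uniform_bound (fun i d => forall v : X i,
    `|x i + v| <= `|x i| + d -> `|x i - v| <= `|x i| + d -> `|v| <= e') n
  (fun k d d' dd h w h1 h2 => h w
    (le_trans h1 (lerD (lexx _) (proj2 (andP dd))))
    (le_trans h2 (lerD (lexx _) (proj2 (andP dd)))))
  (fun k => mX k (x k) _ e'0).
have [d d0 dC] : exists2 d : R, 0 < d &
    (`|x| + d) ^+ 2 - `|x| ^+ 2 <= Num.min (e ^+ 2 / 4) ((D / 2) ^+ 2).
  apply: sqrD_close => //.
  by rewrite lt_min; apply/andP; split; rewrite ?divr_gt0 ?exprn_gt0 ?divr_gt0.
move: dC; rewrite le_min => /andP[dC dD].
exists d => // v xv1 xv2.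
pose a i := `|x i + v i|; pose b i := `|x i - v i|; pose c i := `|x i|.
have aoo : (sqsum 0 a < +oo)%E by exact: (l2sumP (x + v : l2sum X)).
have boo : (sqsum 0 b < +oo)%E by exact: (l2sumP (x - v : l2sum X)).
have cab i : 2 * c i <= a i + b i.
  have -> : 2 * c i = `|(x i + v i) + (x i - v i)|.
    by rewrite addrACA subrr addr0 -mulr2n normrMn mulr_natl.
  exact: ler_normD.
have cba i : 2 * c i <= b i + a i by rewrite addrC.
have sD : 2 * Num.sqrt ((`|x| + d) ^+ 2 - `|x| ^+ 2) <= D.
  have D20 : 0 <= D / 2 by lra.
  rewrite -ler_pdivlMl// [_^-1 * D]mulrC -(ger0_norm D20) -(sqrtr_sqr (D / 2)).
  exact: ler_wsqrtr.
have vi i : (i < n)%N -> `|v i| <= e'.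
  move=> ni; apply: (xD i ni).
    have := seqnorm_midpoint aoo boo (fun k => normr_ge0 (x k)) cab xv1 xv2
      (leq0n i).
    by rewrite -l2sum_normE => /le_trans; apply; rewrite lerD2l.
  have := seqnorm_midpoint boo aoo (fun k => normr_ge0 (x k)) cba xv2 xv1
    (leq0n i).
  by rewrite -l2sum_normE => /le_trans; apply; rewrite lerD2l.
rewrite l2sum_normE; apply: seqnorm_le => [|N]; first exact: ltW.
apply: (@le_trans _ _ (\sum_(0 <= i < maxn n N) `|v i| ^+ 2)).
  rewrite [leRHS](@big_cat_nat _ _ _ N)/= ?leq_maxr// lerDl.
  by apply: sumr_ge0 => i _; exact: sqr_ge0.
rewrite (@big_cat_nat _ _ _ n)/= ?leq_maxl//.
have head : \sum_(0 <= i < n) `|v i| ^+ 2 <= e ^+ 2 / 4.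
  apply: (@le_trans _ _ (\sum_(0 <= i < n) e' ^+ 2)).
    rewrite !big_nat; apply: ler_sum => i /andP[_ ni].
    by rewrite ler_sqr ?nnegrE ?vi// ltW.
  rewrite sumr_const_nat subn0.
  have -> : e' ^+ 2 *+ n = e ^+ 2 / 4 * (n%:R / n.+1%:R ^+ 2).
    by rewrite -mulr_natl /e'; field; rewrite gt_eqF.
  rewrite ler_piMr ?divr_ge0 ?sqr_ge0// ler_pdivrMr ?exprn_gt0// mul1r -natrX.
  by rewrite ler_nat; nia.
(* On the tail, [|v i|] is at most the mean of [a i] and [b i], and the mean
   of [a] and [b] has already used up the head of [x]. *)
have tail : \sum_(n <= i < maxn n N) `|v i| ^+ 2 <= e ^+ 2 / 2.
  have A := psum_le_seqnorm (maxn n N) aoo.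
  have B := psum_le_seqnorm (maxn n N) boo.
  have sqn y C : `|y| <= C -> `|y| ^+ 2 <= C ^+ 2 :> R.
    by move=> yC; rewrite ler_sqr ?nnegrE// (le_trans (normr_ge0 y)).
  have A2 : seqnorm 0 a ^+ 2 <= (`|x| + d) ^+ 2.
    by rewrite ler_sqr ?nnegrE ?seqnorm_ge0// addr_ge0// ltW.
  have B2 : seqnorm 0 b ^+ 2 <= (`|x| + d) ^+ 2.
    by rewrite ler_sqr ?nnegrE ?seqnorm_ge0// addr_ge0// ltW.
  move: A B; rewrite (@big_cat_nat _ _ _ n 0 (maxn n N))/= ?leq_maxl//.
  rewrite (@big_cat_nat _ _ _ n 0 (maxn n N))/= ?leq_maxl// => A B.
  have H : \sum_(0 <= i < n) `|x i| ^+ 2 <=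
      (\sum_(0 <= i < n) a i ^+ 2 + \sum_(0 <= i < n) b i ^+ 2) / 2.
    rewrite -big_split/= mulr_suml; apply: ler_sum => i _.
    have := cab i; have : 0 <= c i by exact: normr_ge0. rewrite -/(c i).
    have := sqr_ge0 (a i - b i); nra.
  have T : \sum_(n <= i < maxn n N) `|v i| ^+ 2 <=
      (\sum_(n <= i < maxn n N) a i ^+ 2 +
       \sum_(n <= i < maxn n N) b i ^+ 2) / 2.
    rewrite -big_split/= mulr_suml; apply: ler_sum => i _.
    have h : 2 * `|v i| <= a i + b i.
      have -> : 2 * `|v i| = `|(x i + v i) - (x i - v i)|.
        by rewrite opprB addrCA [x i + v i]addrC addrK -mulr2n normrMn mulr_natl.
      exact: ler_normB.
    have : 0 <= `|v i| by []; have := sqr_ge0 (a i - b i); nra.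
  lra.
have := sqr_ge0 e; lra.
Qed.

End Mlur.

Section XDMlur.
Context {R : realType}.
Variable eps : nat -> {posnum R}.

Lemma supnorm_midpoint (D : set (I01 R)) (x v : C01 R) :
  2 * supnorm D x <= supnorm D (x + v) + supnorm D (x - v).
Proof.
rewrite -[2]ger0_norm// -supnormZ.
have -> : 2 *: x = (x + v) + (x - v).
  by rewrite addrACA subrr addr0 -mulr2n scaler_nat.
exact: supnormD.
Qed.

(** The weighted seminorm of index [n]: the norm of [XD eps i] is the [l_2]
    norm of the sequence of these seminorms. *)
Definition wsup i (x : C01 R) (n : nat) : R :=
  Num.sqrt (2 ^- n) * supnorm (baseD eps i n) x.

Lemma XD_normE i (x : XD eps i) : `|x| = seqnorm 1 (wsup i x).
Proof. exact: normDE. Qed.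

Lemma wsup_fin i (x : C01 R) : (sqsum 1 (wsup i x) < +oo)%E.
Proof. exact: (@normD_fin R eps i x). Qed.

Lemma wsup_ge0 i (x : C01 R) n : 0 <= wsup i x n.
Proof. by rewrite mulr_ge0 ?sqrtr_ge0 ?supnorm_ge0. Qed.

Lemma sqrt_exp2V_gt0 n : 0 < Num.sqrt (2 ^- n) :> R.
Proof. by rewrite sqrtr_gt0 invr_gt0 exprn_gt0. Qed.

Lemma sqrt_exp2V_le1 n : Num.sqrt (2 ^- n) <= 1 :> R.
Proof.
by rewrite -[leRHS]sqrtr1 ler_wsqrtr// invf_le1 ?exprn_gt0// exprn_ege1// ler1n.
Qed.

Lemma nbhs_I01P (t : I01 R) (W : set (I01 R)) : nbhs t W ->
  exists2 r : R, 0 < r & forall s : I01 R, `|set_val s - set_val t| < r -> W s.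
Proof.
move=> /nbhs_ballP[r /= r0 rW]; exists r => // s st; apply: rW.
by have : `|set_val t - set_val s| < r by rewrite distrC.
Qed.

Lemma I01_itv (t : I01 R) : 0 <= set_val t <= 1.
Proof. by have := set_valP t; rewrite /I01/= in_itv. Qed.

Lemma mkI01 (r : R) : 0 <= r <= 1 -> exists t : I01 R, set_val t = r.
Proof.
move=> r01; have h : I01 R r by rewrite /I01/= in_itv.
by exists (exist _ r (mem_set h)).
Qed.

Lemma XD_norm_le i (x : XD eps i) (M : R) : 0 <= M ->
  (forall t, `|x t| <= M) -> `|x| <= M.
Proof.
move=> M0 xM; rewrite XD_normE; apply: seqnorm_le => // n.
have le1 : \sum_(1 <= k < n) 2 ^- k <= 1 :> R.
  case: n => [|n]; first by rewrite big_geq.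
  have -> : \sum_(1 <= k < n.+1) 2 ^- k = 1 - 2 ^- n :> R.
    elim: n => [|n ih]; first by rewrite big_geq// expr0 invr1 subrr.
    by rewrite big_nat_recr//= ih [in RHS]exprS exprS; field; rewrite expf_neq0.
  by rewrite gerBl invr_ge0 exprn_ge0.
apply: (@le_trans _ _ (\sum_(1 <= k < n) 2 ^- k * M ^+ 2)); last first.
  by rewrite -mulr_suml ler_piMl// exprn_ge0.
apply: ler_sum => k _; rewrite /wsup exprMn sqr_sqrtr ?invr_ge0 ?exprn_ge0//.
rewrite ler_wpM2l ?invr_ge0 ?exprn_ge0// ler_sqr ?nnegrE ?supnorm_ge0//.
exact: supnorm_le.
Qed.

Lemma baseD_itv i n : exists lo hi : R, forall t,
  baseD eps i n t = (lo < set_val t < hi) :> Prop.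
Proof.
pose m := (n + 2 ^ i - 2)%N.
by exists (((bpos m)%:R - 1) / 2 ^+ blevel m - (eps m)%:num),
  ((bpos m)%:R / 2 ^+ blevel m + (eps m)%:num).
Qed.

Hypothesis eps0 : (fun n => (eps n)%:num) @ \oo --> (0 : R).

(** Each [D_i] contains arbitrarily small neighbourhoods of every point. *)
Lemma base_nbhs i (t : I01 R) (r : R) : (0 < i)%N -> 0 < r ->
  exists n, [/\ (0 < n)%N, baseD eps i n t &
    forall s, baseD eps i n s -> `|set_val s - set_val t| < r].
Proof.
move=> i0 r0; have r3 : 0 < r / 3 by rewrite divr_gt0.
have [l [il lr epsr]] : exists l, [/\ (i <= l)%N, 2 ^- l < r / 3 :> R &
    forall m, (l <= m)%N -> (eps m)%:num < r / 3].
  have /cvgrPdist_lt/(_ _ r3)[l1 _ h1] := eps0.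
  have /cvgrPdist_lt/(_ _ r3)[l2 _ h2] : (2 ^- n : R) @[n --> \oo] --> (0 : R).
    under eq_fun do rewrite -exprVn; apply: cvg_expr.
    by rewrite ger0_norm ?invr_ge0// invf_lt1// ltr1n.
  exists (maxn i (maxn l1 l2)); split; first exact: leq_maxl.
    have := h2 (maxn i (maxn l1 l2)).
    rewrite /= sub0r normrN ger0_norm ?invr_ge0 ?exprn_ge0//; apply.
    by rewrite !leq_max leqnn !orbT.
  move=> m; rewrite !geq_max => /and3P[_ l1m _].
  by have := h1 m l1m; rewrite /= sub0r normrN ger0_norm.
have [n n0 nt] := baseD_cover eps l t.
have pil : (2 ^ i <= 2 ^ l)%N by rewrite leq_exp2l.
have pi2 : (2 <= 2 ^ i)%N by rewrite -{1}(expn1 2) leq_exp2l.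
have E : (n + 2 ^ l - 2 ^ i + 2 ^ i - 2 = n + 2 ^ l - 2)%N by lia.
exists (n + 2 ^ l - 2 ^ i)%N; split; first lia.
  by rewrite /baseD E.
move=> s; rewrite /baseD E; set m := (n + 2 ^ l - 2)%N => ms.
have lm : (l <= blevel m)%N by apply: trunc_log_max => //; rewrite /m; lia.
have em : (eps m)%:num < r / 3.
  by apply: epsr; have := ltn_expl l (ltnSn 1); rewrite /m; lia.
have lr' : 2 ^- blevel m <= 2 ^- l :> R.
  by rewrite lef_pV2 ?posrE ?exprn_gt0// ler_weXn2l// ler1n.
have : baseD1 eps m t := nt; move: ms; rewrite /baseD1 /=.
rewrite !mulrBl mul1r => /andP[s1 s2] /andP[t1 t2].
by rewrite ltr_norml; apply/andP; split; lra.
Qed.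

Lemma XD_local_mlur i : (0 < i)%N -> local_mlur (XD eps i).
Proof.
move=> i0 x e e0; have e2 : 0 < e / 2 by lra.
have e4 : 0 < e / 4 by lra.
(* Finitely many basic sets, on each of which [x] oscillates little, cover
   the interval. *)
have [N NP] : exists N, forall t : I01 R, exists n, [/\ (0 < n < N)%N,
    baseD eps i n t & forall s, baseD eps i n s -> `|x s - x t| < e / 2].
  pose P (N : nat) (r : R) := forall t : I01 R, set_val t = r ->
    exists n, [/\ (0 < n < N)%N, baseD eps i n t &
      forall s, baseD eps i n s -> `|x s - x t| < e / 2].
  suff : \forall N \near \oo, `[0 : R, 1]%classic `<=` P N.
    case=> N _ /(_ N (leqnn N)) NP; exists N => t.
    by apply: (NP (set_val t)) => //; have := I01_itv t; rewrite /= in_itv.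
  have /compact_near_coveringP := @segment_compact R 0 1; apply.
  move=> r r01; have [t0 t0r] : exists t : I01 R, set_val t = r.
    by apply: mkI01; move: r01; rewrite /= in_itv.
  have [d d0 dx] : exists2 d : R, 0 < d & forall s : I01 R,
      `|set_val s - set_val t0| < d -> `|x s - x t0| < e / 4.
    apply: (@nbhs_I01P t0 (fun s => `|x s - x t0| < e / 4)).
    have /cvgrPdist_lt/(_ _ e4) := @cts_fun _ _ x t0.
    by apply: filterS => s; rewrite distrC.
  have [n [n0 nt0 nd]] := base_nbhs t0 i0 d0.
  have osc s : baseD eps i n s -> `|x s - x t0| < e / 4 by move=> /nd/dx.
  have [lo [hi nE]] := baseD_itv i n.
  have /andP[lor rhi] : lo < r < hi by rewrite -t0r -nE.
  near=> r' N; have lor' : lo < r' by near: r'; exact: lt_nbhsr.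
  have rhi' : r' < hi by near: r'; exact: lt_nbhsl.
  have nN : (n < N)%N by near: N; exact: nbhs_infty_gt.
  move=> t tr'; exists n.
  have nt : baseD eps i n t by rewrite nE tr' lor' rhi'.
  split=> //; first by rewrite n0.
  move=> s /osc xs; have xt := osc _ nt.
  rewrite (_ : x s - x t = (x s - x t0) - (x t - x t0)); last by lra.
  by rewrite (le_lt_trans (ler_normB _ _))//; lra.
(* A common lower bound for the weights of index below [N], times [e / 2]. *)
have [m m0 mN] : exists2 m : R, 0 < m & forall n, (n < N)%N ->
    m <= Num.sqrt (2 ^- n) * (e / 2).
  apply: (uniform_bound (P := fun n d => d <= Num.sqrt (2 ^- n) * (e / 2))).
    by move=> k d d' /andP[_ d'd] /(le_trans d'd).
  by move=> k; exists (Num.sqrt (2 ^- k) * (e / 2)) => //;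
    rewrite mulr_gt0// sqrt_exp2V_gt0.
have m2 : 0 < (m / 2) ^+ 2 by rewrite exprn_gt0// divr_gt0.
have [d d0 dm] := sqrD_close (normr_ge0 x) m2.
exists d => // v xv1 xv2.
have sm : 2 * Num.sqrt ((`|x| + d) ^+ 2 - `|x| ^+ 2) <= m.
  have m20 : 0 <= m / 2 by lra.
  rewrite -ler_pdivlMl// [_^-1 * m]mulrC -(ger0_norm m20) -(sqrtr_sqr (m / 2)).
  exact: ler_wsqrtr.
rewrite XD_normE in xv1; rewrite XD_normE in xv2.
have mid k : 2 * wsup i x k <= wsup i (x + v) k + wsup i (x - v) k.
  rewrite /wsup -mulrDr mulrCA ler_pM2l ?sqrt_exp2V_gt0//.
  exact: (supnorm_midpoint (baseD eps i k) x v).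
have mid' k : 2 * wsup i x k <= wsup i (x - v) k + wsup i (x + v) k.
  by rewrite addrC.
have bound (y : C01 R) n : (0 < n < N)%N ->
    wsup i y n <= wsup i x n + 2 * Num.sqrt ((`|x| + d) ^+ 2 - `|x| ^+ 2) ->
    supnorm (baseD eps i n) y <= supnorm (baseD eps i n) x + e / 2.
  move=> /andP[n0 nN] h.
  rewrite -(ler_pM2l (sqrt_exp2V_gt0 n)) mulrDr (le_trans h)// lerD2l.
  by rewrite (le_trans sm)// mN.
(* The sup norm of [v] is at most [e], hence so is its norm. *)
have vsup t : `|v t| <= e.
  have [n [nN nt osc]] := NP t.
  have n1 : (1 <= n)%N by case/andP: nN.
  have A : supnorm (baseD eps i n) (x + v) <= supnorm (baseD eps i n) x + e / 2.
    apply: bound => //; rewrite XD_normE -[X in X + d]XD_normE.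
    exact: (seqnorm_midpoint (wsup_fin i _) (wsup_fin i _) (wsup_ge0 i x) mid
      xv1 xv2 n1).
  have B : supnorm (baseD eps i n) (x - v) <= supnorm (baseD eps i n) x + e / 2.
    apply: bound => //; rewrite XD_normE -[X in X + d]XD_normE.
    exact: (seqnorm_midpoint (wsup_fin i _) (wsup_fin i _) (wsup_ge0 i x) mid'
      xv2 xv1 n1).
  have C : supnorm (baseD eps i n) x <= `|x t| + e / 2.
    apply: supnorm_le => [|s ns]; first by rewrite addr_ge0// ltW.
    have /ltW := osc s ns.
    by rewrite -lerBlDl; apply: le_trans; exact: lerB_dist.
  have {A} := le_trans (supnorm_ub (x + v : C01 R) nt) A.
  have {B} := le_trans (supnorm_ub (x - v : C01 R) nt) B.
  rewrite -[(x + v : C01 R) t]/(x t + v t) -[(x - v : C01 R) t]/(x t - v t).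
  rewrite !ler_norml => /andP[B1 B2] /andP[A1 A2].
  by move: C; case: (ger0P (x t)); case: (ger0P (v t)); lra.
by apply: XD_norm_le => //; exact: ltW.
Unshelve. all: by end_near. Qed.

End XDMlur.

(** * Bumps sliding towards finitely many points *)

Section Bumps.
Context {R : realType}.
Implicit Types (s : seq R) (k n : nat) (t y : R).

(** A continuous function vanishing exactly at the points of [s]. *)
Definition zero_at s t : R := \prod_(a <- s) `|t - a|.

(** The function [y |-> 2 ^ k y - 1], cut off to take its values in [0, 1]. *)
Definition ramp k y : R := Num.min 1 (Num.max 0 (2 ^+ k * y - 1)).

(** The bumps attached to [s]: nonnegative functions with sum at most [1],
    the [k]-th one being equal to [1] where [zero_at s] is [2 ^- k]. *)
Definition bump s k t : R := ramp k.+1 (zero_at s t) - ramp k (zero_at s t).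

Lemma zero_at_ge0 s t : 0 <= zero_at s t.
Proof. by apply: prodr_ge0. Qed.

Lemma zero_at_mem s t : t \in s -> zero_at s t = 0.
Proof.
move=> ts; apply/eqP; rewrite /zero_at prodf_seq_eq0; apply/hasP.
by exists t => //=; rewrite subrr normr0.
Qed.

Lemma zero_at_neq0 s t : t \notin s -> 0 < zero_at s t.
Proof.
move=> ts; rewrite lt_neqAle zero_at_ge0 andbT eq_sym prodf_seq_neq0.
apply/allP => a sa /=; rewrite normr_eq0 subr_eq0.
by apply: contraNneq ts => ->.
Qed.

Lemma continuous_zero_at s : continuous (zero_at s).
Proof.
elim: s => [|a s ih] t.
  under [zero_at _]funext => u do rewrite /zero_at big_nil.
  exact: cvg_cst.
under [zero_at _]funext => u do rewrite /zero_at big_cons.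
apply: cvgM; last exact: ih.
by apply: cvg_norm; apply: cvgB; [exact: cvg_id|exact: cvg_cst].
Qed.

Lemma ramp_itv k y : 0 <= ramp k y <= 1.
Proof. by rewrite /ramp le_min ler01 le_max lexx/= ge_min lexx. Qed.

Lemma ramp_le k y : 0 <= y -> ramp k y <= ramp k.+1 y.
Proof.
move=> y0; rewrite /ramp exprS.
have : 0 <= 2 ^+ k * y by rewrite mulr_ge0// exprn_ge0.
rewrite -mulrA; set z := _ * y => z0.
rewrite le_min ge_min lexx/= ge_min; apply/orP; right.
by rewrite ge_max !le_max lexx/=; apply/orP; right; lra.
Qed.

Lemma continuous_ramp k : continuous (ramp k).
Proof.
move=> y.
apply: (@continuous_min R R (cst 1) (fun u => Num.max 0 (2 ^+ k * u - 1)) y).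
  exact: cvg_cst.
apply: (@continuous_max R R (cst 0) (fun u => 2 ^+ k * u - 1) y).
  exact: cvg_cst.
apply: cvgB; last exact: cvg_cst.
by apply: cvgM; [exact: cvg_cst|exact: cvg_id].
Qed.

Lemma continuous_bump s k : continuous (bump s k).
Proof.
move=> t; apply: cvgB; apply: continuous_comp => //;
  by [exact: continuous_zero_at|exact: continuous_ramp].
Qed.

Lemma bump_ge0 s k t : 0 <= bump s k t.
Proof. by rewrite subr_ge0 ramp_le// zero_at_ge0. Qed.

Lemma bump_sum_le1 s n t : \sum_(0 <= k < n) bump s k t <= 1.
Proof.
rewrite telescope_sumr//.
have /andP[_] := ramp_itv n (zero_at s t).
have /andP[+ _] := ramp_itv 0 (zero_at s t); lra.
Qed.

Lemma bump_le1 s k t : bump s k t <= 1.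
Proof.
have /andP[_] := ramp_itv k.+1 (zero_at s t).
have /andP[+ _] := ramp_itv k (zero_at s t); rewrite /bump; lra.
Qed.

Lemma bump_eq1 s k t : 2 ^+ k * zero_at s t = 1 -> bump s k t = 1.
Proof.
rewrite /bump /ramp exprS -mulrA => ->.
rewrite subrr maxxx mulr1.
have -> : 2 - 1 = 1 :> R by lra.
by rewrite (max_idPr ler01) minxx (min_idPr ler01) subr0.
Qed.

Lemma avoid_seq s (lo hi : R) : lo < hi -> exists2 t, lo < t < hi & t \notin s.
Proof.
elim: s hi => [|a s ih] hi lohi; first by exists ((lo + hi) / 2) => //; lra.
have [/andP[loa ahi]|na] := boolP (lo < a < hi).
  have [t /andP[lot ta] ts] := ih _ loa.
  exists t; first by rewrite lot (lt_trans ta).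
  by rewrite inE negb_or ts lt_eqF.
have [t th ts] := ih _ lohi; exists t => //.
by rewrite inE negb_or ts andbT; apply: contraNneq na => <-.
Qed.

(** By the intermediate value theorem, [zero_at s] takes all small positive
    values on one side of each point of [s]. *)
Lemma bump_peak s (a r : R) : a \in s -> 0 <= a <= 1 -> 0 < r ->
  \forall k \near \oo, exists t, [/\ 0 <= t <= 1, `|t - a| < r & bump s k t = 1].
Proof.
move=> sa a01 r0.
have [b [b01 bar bs]] : exists b, [/\ 0 <= b <= 1, `|b - a| < r & b \notin s].
  have [a1|a1] := ltP a 1.
    have [|b /andP[ab br] bs] := @avoid_seq s a (Num.min 1 (a + r)).
      by rewrite lt_min a1 ltrDl.
    exists b; split=> //; move: br; rewrite lt_min => /andP[b1 br].
      by lra.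
    by rewrite gtr0_norm; lra.
  have [|b /andP[ab br] bs] := @avoid_seq s (Num.max 0 (a - r)) a.
    by rewrite gt_max; lra.
  exists b; split=> //; move: ab; rewrite gt_max => /andP[b1 ab].
    by lra.
  by rewrite ltr0_norm; lra.
have b0 := zero_at_neq0 bs.
have /cvgrPdist_lt/(_ _ b0) : (2 ^- n : R) @[n --> \oo] --> (0 : R).
  under eq_fun do rewrite -exprVn; apply: cvg_expr.
  by rewrite ger0_norm ?invr_ge0// invf_lt1// ltr1n.
apply: filterS => k; rewrite sub0r normrN ger0_norm ?invr_ge0 ?exprn_ge0// => kb.
pose p u : R := a + u * (b - a).
have cp : continuous (zero_at s \o p).
  move=> u; apply: continuous_comp; last exact: continuous_zero_at.
  apply: cvgD; first exact: cvg_cst.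
  by apply: cvgM; [exact: cvg_id|exact: cvg_cst].
have [|u u01 pu] := @IVT R (zero_at s \o p) 0 1 (2 ^- k) ler01
    (continuous_subspaceT cp).
  rewrite /= /p mul0r addr0 mul1r addrCA subrr addr0 (zero_at_mem sa).
  by rewrite ge_min le_max (ltW kb) invr_ge0 exprn_ge0 ?orbT.
move: u01; rewrite in_itv/= => /andP[u0 u1].
exists (p u); split.
- by rewrite /p; apply/andP; split; nra.
- rewrite /p addrAC subrr add0r normrM (le_lt_trans _ bar)// ler_piMl//.
  by rewrite ger0_norm.
- by apply: bump_eq1; move: pu => /= ->; rewrite divff// expf_neq0.
Qed.

Lemma bump_mul_subproof s k (x : C01 R) :
  continuous (fun t : I01 R => bump s k (set_val t) * x t).
Proof.
move=> t; apply: (@continuousM R (I01 R) (bump s k \o set_val) x t);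
  last exact: cts_fun.
apply: continuous_comp; last exact: continuous_bump.
exact: initial_continuous.
Qed.

(** Multiplication by a bump. *)
Definition bump_mul s k (x : C01 R) : C01 R := mkcts (@bump_mul_subproof s k x).

Lemma bump_mul_le s k (x : C01 R) (t : I01 R) : `|bump_mul s k x t| <= `|x t|.
Proof. by rewrite normrM ger0_norm ?bump_ge0// ler_piMl// bump_le1. Qed.

(** Properties that hold eventually for all large enough finite sets of points
    can be required simultaneously for finitely many indices. *)
Lemma finitely_many_points (P : nat -> seq R -> nat -> Prop) n :
  (forall i, exists s0 : seq R, forall s, {subset s0 <= s} ->
    \forall k \near \oo, P i s k) ->
  exists s0 : seq R, forall s, {subset s0 <= s} ->
    \forall k \near \oo, forall i, (i < n)%N -> P i s k.
Proof.
move=> ex; elim: n => [|n [s1 h1]]; first by exists [::] => s _; apply: nearW.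
have [s2 h2] := ex n; exists (s1 ++ s2) => s sub.
have sub1 : {subset s1 <= s} by move=> a sa; apply: sub; rewrite mem_cat sa.
have sub2 : {subset s2 <= s}.
  by move=> a sa; apply: sub; rewrite mem_cat sa orbT.
move: (h1 s sub1) (h2 s sub2); apply: filterS2 => k h1k h2k i.
by rewrite ltnS leq_eqVlt => /predU1P[->//|]; exact: h1k.
Qed.

End Bumps.

(** * Weakly null modifications supported on sliding bumps *)

Lemma sqsum_dominated (R : realType) (m : nat) (u v : nat -> R) :
  (sqsum m v < +oo)%E -> (forall k, `|u k| <= `|v k|) -> (sqsum m u < +oo)%E.
Proof.
move=> voo uv; apply: (le_lt_trans _ (ltry (seqnorm m v ^+ 2))).
apply: sqsum_le => n; apply: le_trans (psum_le_seqnorm n voo).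
apply: ler_sum => k _; rewrite -[u k ^+ 2]real_normK ?num_real//.
by rewrite -[v k ^+ 2]real_normK ?num_real// ler_sqr ?nnegrE.
Qed.

Lemma le_mulr_norm (R : realType) (M a b : R) : 0 <= a -> a <= b ->
  M * a <= `|M| * b.
Proof.
move=> a0 ab; apply: (@le_trans _ _ (`|M| * a)).
  by rewrite ler_wpM2r// ler_norm.
by rewrite ler_wpM2l.
Qed.

Section Sliding.
Context {R : realType}.
Variable eps : nat -> {posnum R}.
Implicit Types (x y : Z eps) (s : seq R).

Lemma XD_norm_mono i (x y : XD eps i) :
  (forall t, `|y t| <= `|x t|) -> `|y| <= `|x|.
Proof.
move=> yx; rewrite !XD_normE; apply: le_seqnorm => [|n _]; first exact: wsup_fin.
rewrite !ger0_norm ?wsup_ge0// ler_wpM2l ?sqrtr_ge0//.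
apply: supnorm_le => [|t nt]; first exact: supnorm_ge0.
by rewrite (le_trans (yx t))// supnorm_ub.
Qed.

Lemma Z_norm_mono x y : (forall i t, `|y i t| <= `|x i t|) -> `|y| <= `|x|.
Proof.
move=> yx; rewrite !l2sum_normE; apply: le_seqnorm => [|i _].
  exact: (l2sumP x).
by rewrite !normr_id; exact: XD_norm_mono.
Qed.

Lemma bump_mulZ_subproof s k x :
  (\sum_(0 <= i <oo) (`|bump_mul s k (x i) : XD eps i.+1| ^+ 2)%:E < +oo)%E.
Proof.
apply: (@sqsum_dominated R 0 _ (fun i => `|x i|) (l2sumP x)) => i.
by rewrite !normr_id; apply: XD_norm_mono => t; exact: bump_mul_le.
Qed.

(** Componentwise multiplication by a bump. *)
Definition bump_mulZ s k x : Z eps := L2Sum (bump_mulZ_subproof s k x).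

(** Evaluation of the [i]-th component at the point [t]. *)
Definition evalZ (i : nat) (t : I01 R) (x : Z eps) : R^o := x i t.

Lemma evalZ_is_linear i t : linear (evalZ i t).
Proof. by []. Qed.

HB.instance Definition _ i t :=
  GRing.isLinear.Build R (Z eps) R^o _ (evalZ i t) (evalZ_is_linear i t).

Lemma linear_boundP (X : normedModType R) (f : {linear X -> R^o}) :
  continuous f -> exists M, forall z : X, `|f z| <= M * `|z|.
Proof.
move=> /linear_bounded_continuous/linear_boundedP[M [Mr Mf]].
by exists (M + 1) => z; apply: Mf; rewrite ltrDl.
Qed.

(** The partial sums of [bump_mulZ s k x], with arbitrary signs, are dominated
    by [x]; hence the values of a continuous functional on them are absolutely
    summable. *)
Lemma bump_mulZ_weakly_null s x (f : {linear Z eps -> R^o}) : continuous f ->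
  f (bump_mulZ s k x) @[k --> \oo] --> (0 : R).
Proof.
move=> /linear_boundP[M fM].
pose u k : R := `|f (bump_mulZ s k x)|.
have M0 : 0 <= M * `|x| := le_trans (normr_ge0 _) (fM x).
have usum n : \sum_(0 <= k < n) u k <= `|M| * `|x|.
  pose sg k : R := Num.sg (f (bump_mulZ s k x)).
  pose z : Z eps := \sum_(0 <= k < n) sg k *: bump_mulZ s k x.
  have zx : `|z| <= `|x|.
    apply: Z_norm_mono => i t.
    have -> : z i t = \sum_(0 <= k < n) sg k * (bump s k (set_val t) * x i t).
      rewrite -[LHS]/(evalZ i t z) linear_sum.
      by apply: eq_bigr => k _; rewrite linearZ.
    apply: (le_trans (ler_norm_sum _ _ _)).
    apply: (@le_trans _ _ (\sum_(0 <= k < n) bump s k (set_val t) * `|x i t|)).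
      apply: ler_sum => k _; rewrite !normrM (ger0_norm (bump_ge0 _ _ _)).
      by rewrite ler_piMl ?mulr_ge0 ?bump_ge0// normr_sg lern1 leq_b1.
    by rewrite -mulr_suml; apply: ler_piMl => //; exact: bump_sum_le1.
  have -> : \sum_(0 <= k < n) u k = f z.
    rewrite linear_sum; apply: eq_bigr => k _.
    by rewrite linearZ /u normrEsg.
  apply: (le_trans (ler_norm (f z : R))); apply: (le_trans (fM z)).
  exact: (le_mulr_norm M (normr_ge0 z) zx).
apply/norm_cvg0P; apply: (@cvg_series_cvg_0 R R^o u).
apply: nondecreasing_is_cvgn.
  apply/nondecreasing_seqP => n; rewrite /series/= big_nat_recr//= lerDl.
  exact: normr_ge0.
by exists (`|M| * `|x|) => _ [n _ <-]; exact: usum.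
Qed.

(** Reflecting [x] in a bump does not increase its norm. *)
Lemma bump_reflection_norm s k x : `|x - 2 *: bump_mulZ s k x| <= `|x|.
Proof.
apply: Z_norm_mono => i t.
have -> : (x - 2 *: bump_mulZ s k x) i t = (1 - 2 * bump s k (set_val t)) * x i t.
  rewrite mulrBl mul1r -mulrA; exact: erefl.
rewrite normrM ler_piMl//.
have := bump_ge0 s k (set_val t); have := bump_le1 s k (set_val t).
by rewrite ler_norml => h1 h2; apply/andP; split; lra.
Qed.

(** The points are chosen so as to nearly realize the suprema of [|x|] over the
    finitely many basic sets that carry the norm of [x] up to [c]. *)
Lemma XD_bump_norm i (x : XD eps i) (c : R) : c < `|x| ->
  exists s0 : seq R, forall s, {subset s0 <= s} ->
    \forall k \near \oo, c < `|bump_mul s k x : XD eps i|.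
Proof.
rewrite XD_normE => /(seqnorm_lsc (wsup_fin eps i x) (wsup_ge0 eps i x)).
move=> [n [d [d0 nd]]].
have [|s0 hs0] := @finitely_many_points R (fun m s k =>
  supnorm (baseD eps i m) x - d <= supnorm (baseD eps i m) (bump_mul s k x)) n.
  move=> m; have [D0|/set0P[t1 Dt1]] := eqVneq (baseD eps i m) set0.
    exists [::] => s _; apply: nearW => k.
    by rewrite D0 /supnorm !image_set0 sup0 sub0r oppr_le0 ltW.
  have [t0 Dt0 xt0] : exists2 t0, baseD eps i m t0 &
      supnorm (baseD eps i m) x - d < `|x t0|.
    apply: contrapT => h.
    have xt t : baseD eps i m t -> `|x t| <= supnorm (baseD eps i m) x - d.
      by move=> Dt; rewrite leNgt; apply/negP => xt; apply: h; exists t.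
    have := supnorm_le (le_trans (normr_ge0 _) (xt _ Dt1)) xt.
    by rewrite lerBrDr gerDl leNgt d0.
  have [r r0 rD] : exists2 r : R, 0 < r & forall t : I01 R,
      `|set_val t - set_val t0| < r -> baseD eps i m t /\
        supnorm (baseD eps i m) x - d < `|x t|.
    have [r1 r10 rx] : exists2 r : R, 0 < r & forall t : I01 R,
        `|set_val t - set_val t0| < r -> supnorm (baseD eps i m) x - d < `|x t|.
      apply: (@nbhs_I01P _ t0 (fun t => supnorm (baseD eps i m) x - d < `|x t|)).
      have g0 : 0 < `|x t0| - (supnorm (baseD eps i m) x - d) by rewrite subr_gt0.
      have /cvgrPdist_lt/(_ _ g0) := @cts_fun _ _ x t0.
      by apply: filterS => t /= h; have := lerB_dist (x t0) (x t); move: h; lra.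
    have [lo [hi DE]] := baseD_itv eps i m.
    move: (Dt0); rewrite DE => /andP[lot hit].
    exists (Num.min r1 (Num.min (set_val t0 - lo) (hi - set_val t0))).
      by rewrite !lt_min r10 !subr_gt0 lot.
    move=> t; rewrite !lt_min => /and3P[tr1 tlo thi]; split; last exact: rx.
    rewrite DE; move: tlo thi; rewrite !ltr_norml => /andP[h1 _] /andP[_ h2].
    by apply/andP; split; lra.
  exists [:: set_val t0] => s sub.
  have ts : set_val t0 \in s by apply: sub; rewrite mem_head.
  apply: filterS (bump_peak ts (I01_itv t0) r0) => k [u [u01 ur uk]].
  have [t tu] := mkI01 u01; rewrite -tu in ur uk.
  have [Dt xt] := rD t ur.
  apply: le_trans (ltW xt) _; rewrite (le_trans _ (supnorm_ub _ Dt))//.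
  by rewrite -[bump_mul s k x t]/(bump s k (set_val t) * x t) uk mul1r.
exists s0 => s /hs0; apply: filterS => k hk; rewrite XD_normE; apply: nd.
- exact: wsup_fin.
- exact: wsup_ge0.
- move=> m /andP[_ mn].
  apply: (@le_trans _ _ (Num.sqrt (2 ^- m) * (supnorm (baseD eps i m) x - d))).
    by rewrite mulrBr lerD2l lerN2 ler_piMl ?(ltW d0) ?sqrt_exp2V_le1.
  by rewrite ler_wpM2l ?sqrtr_ge0// hk.
Qed.

Lemma Z_bump_norm x (c : R) : c < `|x| ->
  exists s : seq R, \forall k \near \oo, c < `|bump_mulZ s k x|.
Proof.
rewrite l2sum_normE => /(seqnorm_lsc (l2sumP x) (fun i => normr_ge0 (x i))).
move=> [n [d [d0 nd]]].
have [|s0 hs0] := @finitely_many_points R (fun i s k =>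
  `|x i| - d <= `|bump_mul s k (x i) : XD eps i.+1|) n.
  move=> i; have [|s0 h] := @XD_bump_norm i.+1 (x i) (`|x i| - d).
    by rewrite ltrBlDr ltrDl.
  by exists s0 => s /h; apply: filterS => k /ltW.
exists s0; apply: filterS (hs0 s0 (fun a sa => sa)) => k hk.
rewrite l2sum_normE; apply: nd => [|i|i /andP[_ ni]].
- exact: (l2sumP (bump_mulZ s0 k x)).
- exact: normr_ge0.
- exact: hk.
Qed.

End Sliding.

(** * The diameter properties *)

Section Functionals.
Context {R : realType}.
Variable X : normedModType R.
Implicit Types (x y : X) (f : {linear X -> R^o}).

Lemma linear_bound_continuous f (M : R) :
  (forall x, `|f x| <= M * `|x|) -> continuous f.
Proof.
move=> fM; apply/linear_bounded_continuous/linear_boundedP.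
exists M; split=> [|r Mr x]; first exact: num_real.
by rewrite (le_trans (fM x))// ler_wpM2r// ltW.
Qed.

Lemma dual_norm_ub f x : continuous f -> unit_ball x -> `|f x| <= dual_norm f.
Proof.
move=> /linear_boundP[M fM] x1; apply: ub_le_sup; last by exists x.
exists `|M| => _ [y y1 <-]; rewrite (le_trans (fM y))//.
rewrite (le_trans (ler_wpM2r _ (ler_norm M)))//.
by rewrite ler_piMr.
Qed.

Lemma dual_sphere_le f x : dual_sphere f -> `|f x| <= `|x|.
Proof.
move=> [cf f1]; have [->|x0] := eqVneq x 0; first by rewrite linear0 !normr0.
have nx0 : 0 < `|x| by rewrite normr_gt0.
have : `|f (`|x|^-1 *: x)| <= 1.
  rewrite -f1; apply: dual_norm_ub => //.
  by rewrite /unit_ball/= normrZ normfV normr_id mulVf// gt_eqF.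
by rewrite linearZ normrM normfV normr_id ler_pdivrMl// mulr1.
Qed.

(** Every nonzero continuous functional can be normalized. *)
Lemma dual_sphere_normalize f x : continuous f -> f x != 0 ->
  exists2 g : {linear X -> R^o}, dual_sphere g &
    exists c : R, forall y, g y = c * f y.
Proof.
move=> cf fx0.
have x0 : 0 < `|x|.
  by rewrite normr_gt0; apply: contraNneq fx0 => ->; rewrite linear0.
have c0 : 0 < dual_norm f.
  apply: (@lt_le_trans _ _ `|f (`|x|^-1 *: x)|).
    by rewrite linearZ normr_gt0 mulf_neq0// invr_eq0 gt_eqF.
  apply: dual_norm_ub => //.
  by rewrite /unit_ball/= normrZ normfV normr_id mulVf// gt_eqF.
set c := dual_norm f in c0.
pose g : {linear X -> R^o} := c^-1 \*: f.
have gE y : g y = c^-1 * f y by [].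
have cg : continuous g.
  have [M fM] := linear_boundP cf; apply: (@linear_bound_continuous g (c^-1 * M)).
  move=> y; rewrite gE normrM gtr0_norm ?invr_gt0// -mulrA.
  by rewrite ler_wpM2l// invr_ge0 ltW.
exists g; last by exists c^-1.
split=> //; apply/eqP; rewrite eq_le; apply/andP; split.
  apply: ge_sup; first by exists `|g 0|, 0 => //; rewrite /unit_ball/= normr0.
  move=> _ [y y1 <-]; rewrite gE normrM gtr0_norm ?invr_gt0//.
  by rewrite ler_pdivrMl// mulr1; exact: dual_norm_ub.
rewrite -(ler_pM2l c0) mulr1.
apply: ge_sup; first by exists `|f 0|, 0 => //; rewrite /unit_ball/= normr0.
move=> _ [y y1 <-]; have := dual_norm_ub cg y1.
by rewrite gE normrM gtr0_norm ?invr_gt0// ler_pdivrMl// mulrC.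
Qed.

Lemma diameter_le (A : set X) (M : R) :
  (forall x y, A x -> A y -> `|x - y| <= M) -> (diameter A <= M%:E)%E.
Proof.
by move=> AM; apply: ge_ereal_sup => _ [[x y] [Ax Ay] <-]; rewrite lee_fin AM.
Qed.

Lemma diameter_ge (A : set X) x y : A x -> A y ->
  (`|x - y|%:E <= diameter A)%E.
Proof. by move=> Ax Ay; apply: ereal_sup_ubound; exists (x, y). Qed.

Lemma dist_unit_ball x y : unit_ball x -> unit_ball y -> `|x - y| <= 2.
Proof.
rewrite /unit_ball/= => x1 y1; rewrite (le_trans (ler_normB _ _))//; lra.
Qed.

(** Sequential convergence against every continuous functional is convergence
    in the weak topology. *)
Lemma weak_topology_cvg (y : nat -> X) (x : X) :
  (forall f, continuous f -> f (y k) @[k --> \oo] --> (f x : R)) ->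
  forall U : set (weak_topology X), open U -> U x ->
    \forall k \near \oo, U (y k).
Proof.
move=> yx U Uop Ux.
have : y @ \oo --> (x : weak_topology X).
  apply/cvg_sup => -[f cf] A /= [_ [[B Bop <-] Bfx BA]].
  have fB : nbhs (f x) B by exact: open_nbhs_nbhs.
  by apply: filterS BA _; exact: (yx f cf B fB).
by apply; apply: open_nbhs_nbhs.
Qed.

End Functionals.

Lemma scale_to_sphere (R : realType) (X : normedModType R) (x g : X) (c : R) :
  `|x| <= 1 -> 0 < c -> c < `|g| ->
  exists2 a : R, `|a| <= 2 / c & `|x + a *: g| = 1.
Proof.
move=> x1 c0 cg; have g0 : 0 < `|g| := lt_trans c0 cg.
pose F (a : R) : R := `|x + a *: g|.
have cF : continuous F.
  move=> a; apply: cvg_norm; apply: cvgD; first exact: cvg_cst.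
  exact: scalel_continuous.
have m0 : 0 <= 2 / `|g| by rewrite divr_ge0.
have [|a aI Fa] := @IVT R F 0 (2 / `|g|) 1 m0 (continuous_subspaceT cF).
  have F0 : F 0 <= 1 by rewrite /F scale0r addr0.
  have F1 : 1 <= F (2 / `|g|).
    have := lerB_normD ((2 / `|g|) *: g) x.
    rewrite normrZ ger0_norm// divfK ?gt_eqF// [_ *: g + x]addrC => h.
    by apply: le_trans h; lra.
  by rewrite ge_min F0 le_max F1 orbT.
exists a => //; move: aI; rewrite in_itv/= => /andP[a0 aS].
rewrite ger0_norm// (le_trans aS)// ler_pM2l// lef_pV2 ?posrE//.
exact: ltW.
Qed.

Section ZDiameter.
Context {R : realType}.
Variable eps : nat -> {posnum R}.
Implicit Types (x y : Z eps) (f : {linear Z eps -> R^o}).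

(** A point of the unit sphere is almost at distance [2] from points of the
    unit ball that are arbitrarily close to it in the weak topology: reflect it
    in the sliding bumps. *)
Lemma Z_far_weak_cvg x (d : R) : unit_sphere x -> 0 < d ->
  exists y : nat -> Z eps, [/\ forall k, unit_ball (y k),
    forall f, continuous f -> f (y k) @[k --> \oo] --> (f x : R) &
    \forall k \near \oo, 2 - d < `|x - y k|].
Proof.
move=> x1 d0; have [|s hs] := @Z_bump_norm R eps x (1 - d / 2).
  by rewrite x1; lra.
exists (fun k => x - 2 *: bump_mulZ s k x); split=> [k|f cf|].
- by have := bump_reflection_norm s k x; rewrite x1.
- under eq_fun do rewrite linearB linearZ.
  have h : (f x : R) - 2 * f (bump_mulZ s k x) @[k --> \oo] --> (f x : R) - 2 * 0.
    apply: cvgB; first exact: cvg_cst.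
    by apply: cvgM; [exact: cvg_cst|exact: bump_mulZ_weakly_null].
  by rewrite mulr0 subr0 in h.
- apply: filterS hs => k hk.
  by rewrite opprB addrCA subrr addr0 normrZ ger0_norm//; lra.
Qed.

Lemma Z_LD2Pplus : LD2Pplus (Z eps).
Proof.
move=> f [cf _] e e0 d d0 x [[_ fx] x1].
have [y [y1 fy yd]] := Z_far_weak_cvg x1 d0.
have near_slice : \forall k \near \oo, 1 - e < f (y k).
  exact: (@cvgr_gt _ _ _ _ _ _ (fy f cf)).
have [k [h1 h2]] := filter_ex (filterI near_slice yd).
by exists (y k).
Qed.

Lemma one_at_subproof i : (\sum_(0 <= k <oo)
  (`|if k == i then (cst (1 : R) : C01 R) : XD eps k.+1 else 0| ^+ 2)%:E
    < +oo)%E.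
Proof.
apply: (le_lt_trans _ (ltry (1 : R))).
apply: (@sqsum_le R 0 (fun k =>
  `|if k == i then (cst (1 : R) : C01 R) : XD eps k.+1 else 0|)) => N.
apply: (@le_trans _ _ (\sum_(0 <= k < N | k == i) 1)).
  rewrite [leRHS]big_mkcond/=; apply: ler_sum => k _; case: ifP => _.
    have n1 : `|(cst (1 : R) : C01 R) : XD eps k.+1| <= 1.
      by apply: XD_norm_le => // t; rewrite normr1.
    exact: (exprn_ile1 2 (normr_ge0 _) n1).
  by rewrite normr0 expr0n.
by rewrite big_nat1_eq; case: ifP.
Qed.

(** The vector of [Z eps] whose [i]-th component is the constant function [1],
    the other components being zero. *)
Definition one_at i : Z eps := L2Sum (one_at_subproof i).

Lemma one_atE i t : one_at i i t = 1.
Proof. by rewrite /one_at /= eqxx. Qed.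

Lemma one_at_neq0 i : one_at i != 0.
Proof.
have [t _] : exists t : I01 R, set_val t = 0.
  by apply: mkI01; rewrite lexx ler01.
apply/eqP => h; have := one_atE i t.
by rewrite h -[LHS]/(0 : R) => /eqP; rewrite eq_sym oner_eq0.
Qed.

(** Adding multiples of a weakly null sequence that is bounded away from [0]
    moves any point of the unit ball to the unit sphere without leaving a given
    weak neighbourhood. *)
Lemma weakly_open_meets_sphere (U : set (weak_topology (Z eps))) x :
  open U -> U x -> unit_ball x -> exists2 y : Z eps, U y & unit_sphere y.
Proof.
move=> Uop Ux x1.
have e0 : 0 < `|one_at 0| by rewrite normr_gt0 one_at_neq0.
set c := `|one_at 0| / 2; have c0 : 0 < c by rewrite divr_gt0.
have [|s hs] := @Z_bump_norm R eps (one_at 0) c.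
  by rewrite /c; move: e0; set a := `|_|; lra.
pose g k := bump_mulZ s k (one_at 0).
have reach k : exists a : R, `|a| <= 2 / c /\
    (c < `|g k| -> `|x + a *: g k| = 1).
  have [gk|gk] := ltP c `|g k|; last first.
    by exists 0; rewrite normr0 divr_ge0// ltW.
  by have [a ac ax] := scale_to_sphere x1 c0 gk; exists a.
have [a ha] := choice reach.
have Uy : \forall k \near \oo, U (x + a k *: g k).
  apply: (weak_topology_cvg (x := x)) => // f cf.
  under eq_fun do rewrite linearD linearZ.
  suff h : a k * f (g k) @[k --> \oo] --> (0 : R).
    have h' : (f x : R) + a k * f (g k) @[k --> \oo] --> (f x : R) + 0.
      by apply: cvgD; first exact: cvg_cst.
    by rewrite addr0 in h'.
  apply/norm_cvg0P.
  apply: (@squeeze_cvgr _ _ _ _ (cst 0) (fun k => 2 / c * `|f (g k)|)).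
  - apply: nearW => k; rewrite normr_ge0 normrM ler_wpM2r//.
    by have [] := ha k.
  - exact: cvg_cst.
  - have h : 2 / c * `|f (g k) : R| @[k --> \oo] --> 2 / c * 0.
      apply: cvgM; first exact: cvg_cst.
      by apply/norm_cvg0P; exact: bump_mulZ_weakly_null.
    by rewrite mulr0 in h.
have [k [Uk gk]] := filter_ex (filterI Uy hs).
by exists (x + a k *: g k) => //; have [_ ] := ha k; exact.
Qed.

Lemma Z_D2P : D2P (Z eps).
Proof.
move=> U Uop V [x0 [Ux0 x01]].
have [x Ux x1] := weakly_open_meets_sphere Uop Ux0 x01.
apply/eqP; rewrite eq_le; apply/andP; split.
  by apply: diameter_le => y z [_ y1] [_ z1]; exact: dist_unit_ball.
apply/lee_addgt0Pr => d d0.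
have [y [y1 yx yd]] := Z_far_weak_cvg x1 d0.
have [k [Uk dk]] := filter_ex (filterI (weak_topology_cvg yx Uop Ux) yd).
have xb : unit_ball x by move: x1; rewrite /unit_sphere /unit_ball/= => ->.
have := diameter_ge (conj Ux xb : V x) (conj Uk (y1 k) : V (y k)).
move=> /(leeD2r d%:E); apply: le_trans.
by rewrite -EFinD lee_fin -lerBlDr ltW.
Qed.

End ZDiameter.

(** * Small convex combinations of slices in [l_2] sums *)

Section Masks.
Context {R : realType}.
Variable X : nat -> normedModType R.
Implicit Types (x y : l2sum X) (P : pred nat).

Lemma psum_le_l2norm x n : \sum_(0 <= i < n) `|x i| ^+ 2 <= `|x| ^+ 2.
Proof. exact: (psum_le_seqnorm n (l2sumP x)). Qed.

Lemma l2norm_sqr_le x (C : R) :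
  (forall n, \sum_(0 <= i < n) `|x i| ^+ 2 <= C) -> `|x| ^+ 2 <= C.
Proof. exact: (@seqnorm_sqr_le R 0 (fun i => `|x i|)). Qed.

Lemma l2mask_subproof P x :
  (\sum_(0 <= i <oo) (`|if P i then x i else 0| ^+ 2)%:E < +oo)%E.
Proof.
apply: (sqsum_dominated (l2sumP x)) => i; rewrite !normr_id.
by case: ifP => // _; rewrite normr0.
Qed.

(** The coordinate projection keeping the components whose index satisfies
    [P]. *)
Definition l2mask P x : l2sum X := L2Sum (l2mask_subproof P x).

Lemma l2mask_split P x : x = l2mask P x + l2mask (predC P) x.
Proof.
apply: l2sum_inj => i.
rewrite -[RHS]/((if P i then x i else 0) + (if ~~ P i then x i else 0)).
by case: (P i); rewrite ?addr0 ?add0r.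
Qed.

Lemma l2maskB P x y : l2mask P (x - y) = l2mask P x - l2mask P y.
Proof.
apply: l2sum_inj => i.
rewrite -[LHS]/(if P i then x i - y i else 0).
rewrite -[RHS]/((if P i then x i else 0) - (if P i then y i else 0)).
by case: (P i); rewrite ?subr0.
Qed.

Lemma l2mask1_norm j x : `|l2mask (pred1 j) x| ^+ 2 <= `|x j| ^+ 2.
Proof.
apply: l2norm_sqr_le => n.
have -> : \sum_(0 <= i < n) `|l2mask (pred1 j) x i| ^+ 2 =
    \sum_(0 <= i < n | i == j) `|x i| ^+ 2.
  rewrite [RHS]big_mkcond/=; apply: eq_bigr => i _.
  by case: ifP => //; rewrite normr0 expr0n.
by rewrite big_nat1_eq; case: ifP => _; [exact: lexx|exact: sqr_ge0].
Qed.

Lemma l2maskC1_norm j x :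
  `|l2mask (predC (pred1 j)) x| ^+ 2 <= `|x| ^+ 2 - `|x j| ^+ 2.
Proof.
apply: l2norm_sqr_le => n; rewrite lerBrDl.
apply: le_trans (psum_le_l2norm x (maxn n j.+1)).
have ji : j \in index_iota 0 (maxn n j.+1).
  by rewrite mem_index_iota leq_max ltnSn orbT.
rewrite (bigD1_seq j ji)/= ?iota_uniq// lerD2l.
rewrite [leRHS]big_mkcond/= [leRHS](@big_cat_nat _ _ _ n)/= ?leq_maxl//.
rewrite -[leLHS]addr0; apply: lerD.
  apply: ler_sum => i _.
  by case: ifP => _; rewrite ?lexx// normr0 expr0n.
by apply: sumr_ge0 => i _; case: ifP => _; rewrite ?sqr_ge0.
Qed.

Lemma l2sum_pythagoras x y : (forall i, x i = 0 \/ y i = 0) ->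
  `|x + y| ^+ 2 <= `|x| ^+ 2 + `|y| ^+ 2.
Proof.
move=> xy; apply: l2norm_sqr_le => n.
apply: le_trans (lerD (psum_le_l2norm x n) (psum_le_l2norm y n)).
rewrite -big_split/=; apply: ler_sum => i _.
by have [->|->] := xy i; rewrite ?add0r ?addr0 normr0 expr0n ?add0r ?addr0.
Qed.

Lemma l2sum_sumE (I : Type) (r : seq I) (x : I -> l2sum X) i :
  (\sum_(k <- r) x k) i = \sum_(k <- r) x k i.
Proof. by apply: (big_morph (fun z : l2sum X => z i)). Qed.

Lemma l2mask1_sum_norm m (d : 'I_m -> l2sum X) :
  `|\sum_(j < m) l2mask (pred1 (j : nat)) (d j)| ^+ 2 <=
    \sum_(j < m) `|d j| ^+ 2.
Proof.
elim: m d => [|m ih] d; first by rewrite !big_ord0 normr0 expr0n.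
rewrite !big_ord_recr; apply: (le_trans (l2sum_pythagoras _)); last first.
  apply: lerD; first exact: (ih (fun j => d (widen_ord (leqnSn m) j))).
  apply: (le_trans (l2mask1_norm _ _)).
  by rewrite ler_sqr ?nnegrE ?normr_ge0//; exact: l2sum_coord_le.
move=> i; have [->|im] := eqVneq i m; [left|right].
  rewrite l2sum_sumE big1// => j _.
  rewrite -[LHS]/(if m == j then _ else 0).
  by rewrite gtn_eqF.
rewrite -[LHS]/(if i == m then _ else 0).
by rewrite (negbTE im).
Qed.

(** If the [j]-th component carries almost all of the norm of [u] and [v], then
    [u - v] almost lives in the [j]-th summand. *)
Lemma l2maskC1_diff_norm j (u v : l2sum X) (e : R) : 0 < e ->
  `|u| <= 1 -> `|v| <= 1 ->
  1 - e ^+ 2 / 2 < `|u j| -> 1 - e ^+ 2 / 2 < `|v j| ->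
  `|l2mask (predC (pred1 j)) (u - v)| <= 2 * e.
Proof.
move=> e0 u1 v1 uj vj.
have one (z : l2sum X) : `|z| <= 1 -> 1 - e ^+ 2 / 2 < `|z j| ->
    `|l2mask (predC (pred1 j)) z| <= e.
  move=> z1 zj; have := l2maskC1_norm j z.
  have zj1 : `|z j| <= 1 := le_trans (l2sum_coord_le z j) z1.
  have := normr_ge0 (l2mask (predC (pred1 j)) z).
  have := normr_ge0 z; move: z1 zj zj1.
  move: `|z| `|z j| `|l2mask _ z| => a b c a1 eb b1 a0 c0 cab.
  rewrite -ler_sqr ?nnegrE ?(ltW e0)//; have := sqr_ge0 (b - 1); nra.
rewrite l2maskB; apply: (le_trans (ler_normB _ _)).
have := one u u1 uj; have := one v v1 vj; lra.
Qed.

(** Take slices [S j], for [j < k ^ 2], given by norm-one functionals that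
    depend on the [j]-th component only. Differences of points of [S j] almost
    live in distinct summands, so the norm of their mean is of the order of
    [k / k ^ 2]. *)
Lemma l2sum_small_convex_combinations_of_slices :
  (forall j, exists2 f : {linear l2sum X -> R^o}, dual_sphere f &
    forall x, `|f x| <= `|x j|) ->
  small_convex_combinations_of_slices (l2sum X).
Proof.
move=> exf d d0.
have exf' j : exists f : {linear l2sum X -> R^o},
    dual_sphere f /\ forall x, `|f x| <= `|x j|.
  by have [g] := exf j; exists g.
have [f fP] := choice exf'.
pose k := (Num.trunc (8 / d)).+1; pose m := (k ^ 2)%N.
have k0 : 0 < k%:R :> R by rewrite ltr0n.
have kd : 2 / k%:R < d / 4.
  have : 8 / d < k%:R by rewrite truncnS_gt.
  by rewrite ltr_pdivrMr// => h; rewrite ltr_pdivrMr//; lra.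
pose e : R := d / 16; have e0 : 0 < e by rewrite divr_gt0.
have mE : m%:R = k%:R ^+ 2 :> R by rewrite natrX.
have m0 : 0 < m%:R :> R by rewrite mE exprn_gt0.
exists m, (fun j : 'I_m => slice (f j) (e ^+ 2 / 2)), (fun=> m%:R^-1); split.
- move=> j; exists (f j), (e ^+ 2 / 2); split=> //; first by have [] := fP j.
  by rewrite divr_gt0// exprn_gt0.
- by move=> _; rewrite invr_ge0 ltW.
- by rewrite sumr_const card_ord -[LHS]mulr_natl divff ?(gt_eqF m0).
apply: (@le_lt_trans _ _ (d / 2)%:E); last by rewrite lte_fin; lra.
apply: diameter_le => _ _ [u uS <-] [v vS <-].
have coord (z : l2sum X) j : slice (f j) (e ^+ 2 / 2) z ->
    1 - e ^+ 2 / 2 < `|z j|.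
  move=> [_ fz]; apply: (lt_le_trans fz).
  by apply: (le_trans (ler_norm _)); have [_] := fP j; exact.
pose D j := u j - v j.
have D2 j : `|D j| <= 2.
  by apply: dist_unit_ball; [have [] := uS j|have [] := vS j].
have -> : \sum_(j < m) m%:R^-1 *: u j - \sum_(j < m) m%:R^-1 *: v j =
    m%:R^-1 *: (\sum_(j < m) l2mask (pred1 (j : nat)) (D j) +
                \sum_(j < m) l2mask (predC (pred1 (j : nat))) (D j)).
  rewrite -big_split -sumrB scaler_sumr; apply: eq_bigr => j _.
  rewrite -scalerBr; congr (_ *: _); exact: l2mask_split.
have S1 : `|\sum_(j < m) l2mask (pred1 (j : nat)) (D j)| <= 2 * k%:R.
  have : `|\sum_(j < m) l2mask (pred1 (j : nat)) (D j)| ^+ 2 <= (2 * k%:R) ^+ 2.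
    apply: (le_trans (l2mask1_sum_norm D)).
    apply: (@le_trans _ _ (\sum_(j < m) 2 ^+ 2)).
      by apply: ler_sum => j _; rewrite ler_sqr ?nnegrE ?normr_ge0.
    by rewrite sumr_const card_ord -[leLHS]mulr_natl mE exprMn mulrC.
  by rewrite ler_sqr ?nnegrE ?normr_ge0.
have S2 : `|\sum_(j < m) l2mask (predC (pred1 (j : nat))) (D j)| <= m%:R * (2 * e).
  apply: (le_trans (ler_norm_sum _ _ _)).
  apply: (@le_trans _ _ (\sum_(j < m) 2 * e)); last first.
    by rewrite sumr_const card_ord -[leLHS]mulr_natl.
  apply: ler_sum => j _; apply: l2maskC1_diff_norm => //.
  - by have [] := uS j.
  - by have [] := vS j.
  - exact: (coord _ _ (uS j)).
  - exact: (coord _ _ (vS j)).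
rewrite normrZ gtr0_norm ?invr_gt0//.
apply: (@le_trans _ _ (m%:R^-1 * (2 * k%:R + m%:R * (2 * e)))).
  apply: ler_wpM2l; first by rewrite invr_ge0 ltW.
  exact: (le_trans (ler_normD _ _) (lerD S1 S2)).
have -> : m%:R^-1 * (2 * k%:R + m%:R * (2 * e)) = 2 / k%:R + 2 * e.
  by rewrite mE; field; rewrite gt_eqF.
by rewrite /e; lra.
Qed.

End Masks.

Section ZSlices.
Context {R : realType}.
Variable eps : nat -> {posnum R}.

Lemma eval_le_XD_norm i (t : I01 R) :
  exists M : R, forall x : XD eps i, `|x t| <= M * `|x|.
Proof.
have [n n1 nt] := baseD_cover eps i t.
exists (Num.sqrt (2 ^- n))^-1 => x.
have w0 := @sqrt_exp2V_gt0 R n.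
rewrite mulrC ler_pdivlMr// mulrC.
apply: (@le_trans _ _ (wsup eps i x n)).
  by apply: ler_wpM2l; [exact: ltW|exact: supnorm_ub].
rewrite XD_normE -[leLHS]ger0_norm ?wsup_ge0//.
by apply: coord_le_seqnorm => //; exact: wsup_fin.
Qed.

Lemma Z_small_convex_combinations_of_slices :
  small_convex_combinations_of_slices (Z eps).
Proof.
apply: l2sum_small_convex_combinations_of_slices => j.
have [t _] : exists t : I01 R, set_val t = 0.
  by apply: mkI01; rewrite lexx ler01.
have [M hM] := eval_le_XD_norm j.+1 t.
have cf : continuous (evalZ j t : {linear Z eps -> R^o}).
  apply: (@linear_bound_continuous _ _ _ `|M|) => x.
  apply: (le_trans (hM (x j))); apply: le_mulr_norm.
    exact: normr_ge0.
  exact: (@l2sum_coord_le R (fun i => XD eps i.+1) x j).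
have [|g gs [c gc]] := @dual_sphere_normalize _ _ (evalZ j t) (one_at eps j) cf.
  apply/eqP => h; have /eqP := etrans (esym (one_atE eps j t)) h.
  by rewrite oner_eq0.
exists g => // x.
have -> : g x = g (l2mask (pred1 j) x).
  rewrite !gc; congr (_ * _).
  have h : l2mask (pred1 j) x j = x j by rewrite /= eqxx.
  exact: (esym (congr1 (fun y : C01 R => y t) h)).
apply: (le_trans (dual_sphere_le _ gs)).
have := l2mask1_norm j x.
by rewrite ler_sqr ?nnegrE ?normr_ge0.
Qed.

Lemma Z_MLUR : (fun n => (eps n)%:num) @ \oo --> (0 : R) -> MLUR (Z eps).
Proof.
move=> eps0; apply: local_mlur_MLUR; apply: l2sum_local_mlur => i.
exact: XD_local_mlur.
Qed.

End ZSlices.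

Theorem theorem2p11 (R : realType) :
  exists eta : nat -> {posnum R},
    (fun n => (eta n)%:num) @ \oo --> (0 : R) /\
    forall eps : nat -> {posnum R},
      (forall n : nat, (1 <= n)%N -> (eps n.+1)%:num < (eps n)%:num) ->
      (forall n : nat, (1 <= n)%N -> (eps n)%:num <= (eta n)%:num) ->
      [/\ MLUR (Z eps), D2P (Z eps), LD2Pplus (Z eps)
        & small_convex_combinations_of_slices (Z eps)].
Proof.
have eta0 n : 0 < (n.+1%:R^-1 : R) by rewrite invr_gt0 ltr0n.
exists (fun n => PosNum (eta0 n)); split; first exact: cvg_harmonic.
move=> eps _ eps_le.
have eps0 : (fun n => (eps n)%:num) @ \oo --> (0 : R).
  apply: (@squeeze_cvgr _ _ _ _ (cst 0) (fun n => n.+1%:R^-1)).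
  - exists 1%N => // n n1 /=; apply/andP; split; first by [].
    exact: eps_le.
  - exact: cvg_cst.
  - exact: cvg_harmonic.
split.
- exact: Z_MLUR.
- exact: Z_D2P.
- exact: Z_LD2Pplus.
- exact: Z_small_convex_combinations_of_slices.
Qed.
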